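(* Let $C_{\mathbb{Q}}$ be a smooth, proper, geometrically integral curve over $\mathbb{Q}$ of genus $g\ge2$, $p>2$ a prime of good reduction, $C/\mathbb{Z}_{(p)}$ a smooth proper model with Jacobian $J$, with Mordell--Weil rank $r<g$, and $b\in C(\mathbb{Z}_{(p)})$. Consider the following procedure: (1) compute $S:=C(\mathbb{Z}_p)_{\mathrm{CC}}$; (2) choose $E_1,\dots,E_{r'}\in J(\mathbb{Z}_{(p)})$ topologically generating $M_0$ and a $\mathbb{Z}_p$-basis $\omega_1,\dots,\omega_g$ of $H^0(J_{\mathbb{Z}_p},\Omega^1_{J_{\mathbb{Z}_p}})$; (3) compute $\log E_i=(\frac1p\int_0^{E_i}\omega_j)_{j=1}^g\in\mathbb{Z}_p^g$; (4) remove from $S$ every $R$ with $J(\mathbb{Z}_{(p)})_{\overline R-\overline b}=\emptyset$ (i.e. failing the Mordell--Weil sieve at $p$); (5) for each remaining $R\in S$, pick $T\in J(\mathbb{Z}_{(p)})_{\overline R-\overline b}$ and remove $R$ from $S$ if $\log(R-b-T)=(\frac1p\int_0^{R-b-T}\omega_j)_{j}$ is not a $\mathbb{Z}_p$-linear combination of $\log E_1,\dots,\log E_{r'}$; (6) return $S$. Then the output $S$ satisfies $\mathrm{AJ}_b(S)=\mathrm{AJ}_b(C(\mathbb{Z}_p))\cap M$.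
   Context: $\mathrm{AJ}_b\colon C(\mathbb{Z}_p)\to J(\mathbb{Z}_p)$, $P\mapsto[P-b]$. $M$ is the $p$-adic closure of $J(\mathbb{Z}_{(p)})$ in $J(\mathbb{Z}_p)$, $r'$ the $\mathbb{Z}_p$-rank of $M/M^{\mathrm{tors}}$, and $M_0$ the subgroup of $M$ of elements reducing to $0$ in $J(\mathbb{F}_p)$. For $Q\in J(\mathbb{F}_p)$, $J(\mathbb{Z}_{(p)})_Q$ denotes the points reducing to $Q$. Integrals $\frac1p\int_0^x\omega$ are (normalized) Coleman integrals, giving the logarithm on the kernel of reduction $J(\mathbb{Z}_p)_0$. The Chabauty--Coleman set is $C(\mathbb{Z}_p)_{\mathrm{CC}}=\{P\in C(\mathbb{Z}_p):\frac1p\int_0^{P-b}\nu=0\ \forall\nu\in V\}$, where $V=\{\nu\in H^0(J_{\mathbb{Z}_p},\Omega^1_{J_{\mathbb{Z}_p}}):\frac1p\int_0^m\nu=0\ \forall m\in M\}$. *)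

(* Defs.v *)
From HB Require Import structures.
From mathcomp Require Import all_boot all_order all_algebra.
From mathcomp Require Import boolp functions.
From mathcomp Require Import mpoly ring zify.

Set Implicit Arguments.
Unset Strict Implicit.
Unset Printing Implicit Defensive.

Import Order.TTheory GRing.Theory Num.Theory.
Local Open Scope ring_scope.

(* R[e]/(e^2), with (a, b) standing for a + b e; the multiplication is not the
   componentwise one of the product type. *)
Definition dual (R : comNzRingType) : Type := (R * R)%type.

Section Dual.
Variable R : comNzRingType.
HB.instance Definition _ := GRing.Zmodule.copy (dual R) (R * R)%type.
Definition dual_one : dual R := (1, 0).
Definition dual_mul (x y : dual R) : dual R :=
  (x.1 * y.1, x.1 * y.2 + x.2 * y.1).
Fact dual_mulA : associative dual_mul.
Proof. by move=> [a a'] [b b'] [c c']; congr (_, _) => /=; ring. Qed.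
Fact dual_mulC : commutative dual_mul.
Proof. by move=> [a a'] [b b']; congr (_, _) => /=; ring. Qed.
Fact dual_mul1 : left_id dual_one dual_mul.
Proof. by move=> [a a']; congr (_, _) => /=; ring. Qed.
Fact dual_mulDl : left_distributive dual_mul +%R.
Proof. by move=> [a a'] [b b'] [c c']; congr (_, _) => /=; ring. Qed.
Fact dual_one_neq0 : dual_one != 0.
Proof. by apply/eqP => -[] /eqP; rewrite oner_eq0. Qed.
HB.instance Definition _ := GRing.Zmodule_isComNzRing.Build (dual R)
  dual_mulA dual_mulC dual_mul1 dual_mulDl dual_one_neq0.

Definition dual_fst (x : dual R) : R := x.1.
Fact dual_fst_additive : additive dual_fst. Proof. by []. Qed.
Fact dual_fst_multiplicative : multiplicative dual_fst. Proof. by []. Qed.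
HB.instance Definition _ := GRing.isAdditive.Build (dual R) R dual_fst
  dual_fst_additive.
HB.instance Definition _ := GRing.isMultiplicative.Build (dual R) R dual_fst
  dual_fst_multiplicative.

(* e |-> r e *)
Definition dual_scale (r : R) (x : dual R) : dual R := (x.1, r * x.2).
Fact dual_scale_additive r : additive (dual_scale r).
Proof. by move=> [a a'] [b b']; congr (_, _) => /=; ring. Qed.
Fact dual_scale_multiplicative r : multiplicative (dual_scale r).
Proof.
by split=> [[a a'] [b b']|]; congr (_, _) => /=; ring.
Qed.
HB.instance Definition _ r := GRing.isAdditive.Build (dual R) (dual R)
  (dual_scale r) (dual_scale_additive r).
HB.instance Definition _ r := GRing.isMultiplicative.Build (dual R) (dual R)
  (dual_scale r) (dual_scale_multiplicative r).
End Dual.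

Section DualMap.
Variables (R S : comNzRingType) (f : {rmorphism R -> S}).
Definition dual_map (x : dual R) : dual S := (f x.1, f x.2).
Fact dual_map_additive : additive dual_map.
Proof. by move=> [a a'] [b b']; congr (_, _) => /=; rewrite rmorphB. Qed.
Fact dual_map_multiplicative : multiplicative dual_map.
Proof.
split=> [[a a'] [b b']|]; congr (_, _); rewrite /= ?rmorph1 ?rmorph0 //.
  by rewrite rmorphM.
by rewrite rmorphD !rmorphM.
Qed.
HB.instance Definition _ := GRing.isAdditive.Build (dual R) (dual S)
  dual_map dual_map_additive.
HB.instance Definition _ := GRing.isMultiplicative.Build (dual R) (dual S)
  dual_map dual_map_multiplicative.
End DualMap.

(* R[[t]] as coefficient sequences; the multiplication is the Cauchy product,
   not the pointwise one of nat -> R. *)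
Definition fps (R : comNzRingType) : Type := nat -> R.

Section Fps.
Variable R : comNzRingType.
HB.instance Definition _ := GRing.Zmodule.copy (fps R) (nat -> R).
Definition fps_one : fps R := fun n => (n == 0)%:R.
Definition fps_mul (f g : fps R) : fps R :=
  fun n => \sum_(i < n.+1) f i * g (n - i)%N.
Definition fps_trunc n (f : fps R) : {poly R} := \poly_(i < n) f i.
Fact fps_mulE N n f g : (n < N)%N ->
  fps_mul f g n = (fps_trunc N f * fps_trunc N g)`_n.
Proof.
move=> ltnN; rewrite coefM; apply: eq_bigr => i _.
by rewrite !coef_poly !ifT //; have := ltn_ord i; lia.
Qed.
Fact fps_truncE N n f : (n < N)%N -> (fps_trunc N f)`_n = f n.
Proof. by move=> h; rewrite coef_poly h. Qed.
Fact fps_mul_ext N n (p q : {poly R}) (r : {poly R}) :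
  (forall m, (m < N)%N -> p`_m = q`_m) -> (n < N)%N -> (p * r)`_n = (q * r)`_n.
Proof.
move=> h ltn; rewrite !coefM; apply: eq_bigr => i _.
by rewrite h //; have := ltn_ord i; lia.
Qed.
Fact fps_mulC : commutative fps_mul.
Proof.
by move=> f g; apply/funext => n; rewrite !(@fps_mulE n.+1) // mulrC.
Qed.
Fact fps_mulA : associative fps_mul.
Proof.
move=> f g h; apply/funext => n; rewrite !(@fps_mulE n.+1) //.
transitivity ((fps_trunc n.+1 g * fps_trunc n.+1 h * fps_trunc n.+1 f)`_n).
  rewrite mulrC; apply: (@fps_mul_ext n.+1) => // m lt.
  by rewrite fps_truncE // (@fps_mulE n.+1).
rewrite mulrC mulrA; apply: (@fps_mul_ext n.+1) => // m lt.
by rewrite fps_truncE // (@fps_mulE n.+1).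
Qed.
Fact fps_mul1 : left_id fps_one fps_mul.
Proof.
move=> f; apply/funext => n; rewrite /fps_mul big_ord_recl subn0 mul1r.
by rewrite big1 ?addr0 // => i _; rewrite mul0r.
Qed.
Fact fps_mulDl : left_distributive fps_mul +%R.
Proof.
move=> f g h; apply/funext => n; rewrite /fps_mul.
rewrite [RHS](_ : _ = \sum_(i < n.+1) f i * h (n - i)%N + \sum_(i < n.+1) g i * h (n - i)%N) //.
rewrite -big_split /=; apply: eq_bigr => i _.
exact: mulrDl.
Qed.
Fact fps_one_neq0 : fps_one != 0.
Proof.
apply/eqP => /(congr1 (fun f => f 0%N)) /eqP.
by rewrite (_ : fps_one 0 = 1) // oner_eq0.
Qed.
HB.instance Definition _ := GRing.Zmodule_isComNzRing.Build (fps R)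
  fps_mulA fps_mulC fps_mul1 fps_mulDl fps_one_neq0.

Definition fps_const (f : fps R) : R := f 0%N.
Fact fps_const_additive : additive fps_const. Proof. by []. Qed.
Fact fps_const_multiplicative : multiplicative fps_const.
Proof.
split=> // f g; rewrite /fps_const /GRing.mul /= /fps_mul big_ord_recl big_ord0.
by rewrite addr0.
Qed.
HB.instance Definition _ := GRing.isAdditive.Build (fps R) R fps_const
  fps_const_additive.
HB.instance Definition _ := GRing.isMultiplicative.Build (fps R) R fps_const
  fps_const_multiplicative.

Definition fps_deriv (f : fps R) : fps R := fun n => f n.+1 *+ n.+1.
(* f(t) |-> f(t + e) = f(t) + f'(t) e *)
Definition fps_shift (f : fps R) : dual (fps R) := (f, fps_deriv f).
Fact fps_derivM (f g : fps R) : 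
  fps_deriv (f * g) = f * fps_deriv g + fps_deriv f * g.
Proof.
apply/funext => n.
have derivE N (h : fps R) m : (m < N)%N -> fps_deriv h m = (fps_trunc N.+1 h)^`()`_m.
  by move=> lt; rewrite coef_deriv fps_truncE.
have mulE N (h k : fps R) m : (m < N)%N -> (h * k) m = (fps_trunc N h * fps_trunc N k)`_m.
  exact: fps_mulE.
rewrite [RHS](_ : _ = (f * fps_deriv g) n + (fps_deriv f * g) n) //.
rewrite /fps_deriv (mulE n.+2) // -coef_deriv derivM coefD addrC.
rewrite !(mulE n.+1) //; congr (_ + _); last first.
  rewrite !coefM; apply: eq_bigr => i _; have := ltn_ord i => lti.
  by rewrite -(derivE n.+1) // !fps_truncE //; lia.
rewrite !coefM; apply: eq_bigr => i _; have := ltn_ord i => lti.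
by rewrite -(derivE n.+1) ?fps_truncE //; lia.
Qed.
Fact fps_shift_additive : additive fps_shift.
Proof.
move=> f g; congr (_, _); apply/funext => n.
by rewrite /fps_deriv /GRing.opp /GRing.add /= mulrnBl.
Qed.
Fact fps_shift_multiplicative : multiplicative fps_shift.
Proof.
split=> [f g|]; congr (_, _); first by rewrite fps_derivM.
by apply/funext => n; rewrite /fps_deriv /GRing.one /= /fps_one mul0rn.
Qed.
HB.instance Definition _ := GRing.isAdditive.Build (fps R) (dual (fps R))
  fps_shift fps_shift_additive.
HB.instance Definition _ := GRing.isMultiplicative.Build (fps R) (dual (fps R))
  fps_shift fps_shift_multiplicative.

Definition fpsC (c : R) : fps R := fun n => if n is 0 then c else 0.
Fact fpsC_additive : additive fpsC.
Proof.
move=> a b; apply/funext => -[|n]; rewrite /GRing.opp /GRing.add //=.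
by rewrite subr0.
Qed.
Fact fpsC_multiplicative : multiplicative fpsC.
Proof.
split=> [a b|]; apply/funext => -[|n] //.
  by rewrite /GRing.mul /= /fps_mul big_ord_recl big_ord0 addr0.
rewrite /GRing.mul /= /fps_mul big_ord_recl mulr0 big1 ?addr0 // => i _.
by rewrite mul0r.
Qed.
HB.instance Definition _ := GRing.isAdditive.Build R (fps R) fpsC
  fpsC_additive.
HB.instance Definition _ := GRing.isMultiplicative.Build R (fps R) fpsC
  fpsC_multiplicative.
End Fps.

Section PadicInt.
Variables (p : nat) (p_pr : prime p).

(* Z/p^(k+2) -> Z/p^(k+1) *)
Definition Zpk_red k (x : 'Z_(p ^ k.+2)) : 'Z_(p ^ k.+1) := (x : nat)%:R.

Fact Zpk_gt1 k : (1 < p ^ k.+1)%N.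
Proof. by rewrite -[1%N](expn0 p) ltn_exp2l // prime_gt1. Qed.
Fact Zpk_mod k a : (a %% p ^ k.+2)%:R = a%:R :> 'Z_(p ^ k.+1).
Proof.
apply: val_inj; rewrite /= !val_Zp_nat ?Zpk_gt1 // modn_dvdm //.
exact: dvdn_exp2l.
Qed.
Fact Zpk_red_add k : nmod_morphism (@Zpk_red k).
Proof.
split=> [|x y]; first by [].
by rewrite /Zpk_red /= [X in (_ %% X)%N]Zp_cast ?Zpk_gt1 // Zpk_mod natrD.
Qed.
Fact Zpk_red_mul k : monoid_morphism (@Zpk_red k).
Proof.
split=> [|x y].
  by rewrite /Zpk_red /= [X in (_ %% X)%N]Zp_cast ?Zpk_gt1 // Zpk_mod.
by rewrite /Zpk_red /= [X in (_ %% X)%N]Zp_cast ?Zpk_gt1 // Zpk_mod natrM.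
Qed.
Fact Zpk_redN k (x : 'Z_(p ^ k.+2)) : Zpk_red (- x) = - Zpk_red x.
Proof.
have [h0 hD] := Zpk_red_add k.
by apply: (addIr (Zpk_red x)); rewrite addNr -hD addNr h0.
Qed.
End PadicInt.

(* Z_p = lim Z/p^(k+1); starting at exponent 1 avoids 'Z_1, which is Z/2. *)
Record padic_int (p : nat) (p_pr : prime p) := PadicInt {
  zp_proj : forall k, 'Z_(p ^ k.+1);
  zp_compat : forall k, Zpk_red (zp_proj k.+1) = zp_proj k }.

Section PadicRing.
Variables (p : nat) (p_pr : prime p).
Local Notation padic_int := (padic_int p_pr).

HB.instance Definition _ := gen_eqMixin padic_int.
HB.instance Definition _ := gen_choiceMixin padic_int.

Fact zp_eq (x y : padic_int) : (forall k, zp_proj x k = zp_proj y k) -> x = y.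
Proof.
case: x y => [x hx] [y hy] /= eqxy.
have {}eqxy : x = y by apply: functional_extensionality_dep.
by case: y / eqxy hy => hy; congr PadicInt; apply: Prop_irrelevance.
Qed.

Fact zp_zero_compat k : Zpk_red (0 : 'Z_(p ^ k.+2)) = 0.
Proof. by []. Qed.
Definition zp_zero : padic_int := PadicInt p_pr zp_zero_compat.
Fact zp_one_compat k : Zpk_red (1 : 'Z_(p ^ k.+2)) = 1.
Proof. by have [] := Zpk_red_mul p_pr k. Qed.
Definition zp_one : padic_int := PadicInt p_pr zp_one_compat.
Fact zp_opp_compat (x : padic_int) k : Zpk_red (- zp_proj x k.+1) = - zp_proj x k.
Proof. by rewrite Zpk_redN // zp_compat. Qed.
Definition zp_opp x : padic_int := PadicInt p_pr (zp_opp_compat x).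
Fact zp_add_compat (x y : padic_int) k :
  Zpk_red (zp_proj x k.+1 + zp_proj y k.+1) = zp_proj x k + zp_proj y k.
Proof. by have [_ ->] := Zpk_red_add p_pr k; rewrite !zp_compat. Qed.
Definition zp_add x y : padic_int := PadicInt p_pr (zp_add_compat x y).
Fact zp_mul_compat (x y : padic_int) k :
  Zpk_red (zp_proj x k.+1 * zp_proj y k.+1) = zp_proj x k * zp_proj y k.
Proof. by have [_ ->] := Zpk_red_mul p_pr k; rewrite !zp_compat. Qed.
Definition zp_mul x y : padic_int := PadicInt p_pr (zp_mul_compat x y).

Fact zp_addA : associative zp_add.
Proof. by move=> x y z; apply: zp_eq => k /=; rewrite addrA. Qed.
Fact zp_addC : commutative zp_add.
Proof. by move=> x y; apply: zp_eq => k /=; rewrite addrC. Qed.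
Fact zp_add0 : left_id zp_zero zp_add.
Proof. by move=> x; apply: zp_eq => k /=; rewrite add0r. Qed.
Fact zp_addN : left_inverse zp_zero zp_opp zp_add.
Proof. by move=> x; apply: zp_eq => k /=; rewrite addNr. Qed.
HB.instance Definition _ :=
  GRing.isZmodule.Build padic_int zp_addA zp_addC zp_add0 zp_addN.

Fact zp_mulA : associative zp_mul.
Proof. by move=> x y z; apply: zp_eq => k /=; rewrite mulrA. Qed.
Fact zp_mulC : commutative zp_mul.
Proof. by move=> x y; apply: zp_eq => k /=; rewrite mulrC. Qed.
Fact zp_mul1 : left_id zp_one zp_mul.
Proof. by move=> x; apply: zp_eq => k /=; rewrite mul1r. Qed.
Fact zp_mulDl : left_distributive zp_mul +%R.
Proof. by move=> x y z; apply: zp_eq => k /=; rewrite mulrDl. Qed.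
Fact zp_one_neq0 : zp_one != 0.
Proof. by apply/eqP => /(congr1 (fun x => zp_proj x 0)) /eqP; rewrite oner_eq0. Qed.
HB.instance Definition _ := GRing.Zmodule_isComNzRing.Build padic_int
  zp_mulA zp_mulC zp_mul1 zp_mulDl zp_one_neq0.

Definition zp_mod k (x : padic_int) : 'Z_(p ^ k.+1) := zp_proj x k.
Fact zp_mod_add k : nmod_morphism (zp_mod k). Proof. by []. Qed.
Fact zp_mod_mul k : monoid_morphism (zp_mod k). Proof. by []. Qed.
HB.instance Definition _ k := GRing.isNmodMorphism.Build padic_int 'Z_(p ^ k.+1)
  (zp_mod k) (zp_mod_add k).
HB.instance Definition _ k := GRing.isMonoidMorphism.Build padic_int 'Z_(p ^ k.+1)
  (zp_mod k) (zp_mod_mul k).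

Definition zp_unit : {pred padic_int} := fun x => `[< exists y, y * x = 1 >].
Definition zp_inv (x : padic_int) : padic_int :=
  if pselect (exists y, y * x = 1) is left h then projT1 (cid h) else x.
Fact zp_mulVx : {in zp_unit, left_inverse 1 zp_inv *%R}.
Proof.
move=> x /asboolP h; rewrite /zp_inv; case: pselect => // h'.
exact: (projT2 (cid h')).
Qed.
Fact zp_unitP (x y : padic_int) : y * x = 1 -> zp_unit x.
Proof. by move=> h; apply/asboolP; exists y. Qed.
Fact zp_inv_out : {in [predC zp_unit], zp_inv =1 id}.
Proof.
move=> x /asboolP h; rewrite /zp_inv; case: pselect => // h'.
Qed.
HB.instance Definition _ := GRing.ComNzRing_hasMulInverse.Build padic_int
  zp_mulVx zp_unitP zp_inv_out.

Fact zp_proj_mod (x : padic_int) k d :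
  zp_proj x (k + d) = zp_proj x k %[mod p ^ k.+1].
Proof.
elim: d => [|d IHd]; first by rewrite addn0.
rewrite -IHd -(zp_compat x (k + d)) /Zpk_red addnS.
rewrite val_Zp_nat ?Zpk_gt1 // modn_dvdm //.
by apply: dvdn_exp2l; rewrite ltnS leq_addr.
Qed.
Fact zp_neq0P (x : padic_int) : x != 0 ->
  exists a, forall d, ~~ (p ^ a.+1 %| zp_proj x (a + d))%N.
Proof.
move=> x0; apply: contrapT => nex; move/eqP: x0; apply.
apply: zp_eq => k; apply: contrapT => xk; apply: nex; exists k => d.
rewrite /dvdn zp_proj_mod; apply/negP => /eqP h; apply: xk.
apply: val_inj => /=; rewrite -h modn_small //.
by have := ltn_ord (zp_proj x k); rewrite [X in (_ < X)%N -> _]Zp_cast ?Zpk_gt1.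
Qed.
Fact zp_mulf_eq0 (x y : padic_int) : x * y = 0 -> (x == 0) || (y == 0).
Proof.
move=> xy0; apply: contrapT => /negP; rewrite negb_or => /andP[].
move=> /zp_neq0P[a /(_ _)/negP hx] /zp_neq0P[b /(_ _)/negP hy].
have {}hx := hx b; have {}hy := hy a; rewrite addnC in hy.
have : (p ^ (a + b).+1 %| zp_proj x (a + b) * zp_proj y (a + b))%N.
  have := congr1 (fun z => nat_of_ord (zp_proj z (a + b))) xy0.
  by rewrite /= [X in (_ %% X)%N]Zp_cast ?Zpk_gt1 // => /eqP.
move: hx hy; set X := nat_of_ord _; set Y := nat_of_ord _.
have [->|X0] := posnP X; first by rewrite dvdn0.
have [->|Y0] := posnP Y; first by rewrite dvdn0.
by rewrite !pfactor_dvdn ?muln_gt0 ?X0 // lognM //; lia.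
Qed.
HB.instance Definition _ := GRing.ComUnitRing_isIntegral.Build padic_int zp_mulf_eq0.

End PadicRing.

Definition padic_rat (p : nat) (p_pr : prime p) : fieldType := {fraction padic_int p_pr}.

Section ZlocRing.
Variable p : nat.
Definition Zloc_pred : {pred rat} := fun x => coprime p `|denq x|.
Fact Zloc_predP (x : rat) : reflect
  (exists a d : int, coprime p `|d| /\ x * d%:~R = a%:~R) (x \in Zloc_pred).
Proof.
apply: (iffP idP) => [h|[a [d [cop eqx]]]].
  by exists (numq x), (denq x); rewrite numqE.
have eqZ : (numq x * d = a * denq x)%R.
  apply: (@intr_inj rat); rewrite !rmorphM /= -eqx.
  by rewrite numqE; ring.
have : (`|denq x| %| `|d|)%N.
  have cop' : coprime `|denq x| `|numq x| by rewrite coprime_sym coprime_num_den.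
  rewrite -(Gauss_dvdr _ cop') -abszM eqZ abszM.
  exact: dvdn_mull.
by move=> /coprime_dvdr/(_ cop).
Qed.
Fact Zloc_subring : subring_closed Zloc_pred.
Proof.
split=> [|x y /Zloc_predP[a [d [hd ea]]] /Zloc_predP[b [e [he eb]]]|
  x y /Zloc_predP[a [d [hd ea]]] /Zloc_predP[b [e [he eb]]]].
- by apply/Zloc_predP; exists 1, 1; rewrite coprimen1 mulr1.
- apply/Zloc_predP; exists (a * e - b * d), (d * e).
  by rewrite abszM coprimeMr hd he rmorphB !rmorphM /= -ea -eb; split=> //; ring.
- apply/Zloc_predP; exists (a * b), (d * e).
  by rewrite abszM coprimeMr hd he !rmorphM /= -ea -eb; split=> //; ring.
Qed.
HB.instance Definition _ := GRing.isSubringClosed.Build rat Zloc_pred Zloc_subring.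
(* the localisation Z_(p), as a subring of the rationals *)
Record Zloc := ZlocOf { zloc_val : rat; _ : zloc_val \in Zloc_pred }.
HB.instance Definition _ := [isSub for zloc_val].
HB.instance Definition _ := [Choice of Zloc by <:].
HB.instance Definition _ := [SubChoice_isSubComNzRing of Zloc by <:].
End ZlocRing.

Section ZlocToZp.
Variables (p : nat) (p_pr : prime p).
Definition zloc_mod k (x : Zloc p) : 'Z_(p ^ k.+1) :=
  (numq (zloc_val x))%:~R / (denq (zloc_val x))%:~R.
Fact zloc_modP k (x : Zloc p) (a d : int) : coprime p `|d| -> 
  zloc_val x * d%:~R = a%:~R ->
  zloc_mod k x = a%:~R / d%:~R /\ (d%:~R : 'Z_(p ^ k.+1)) \is a GRing.unit.
Proof.
have unitZ (m : int) : coprime p `|m| -> (m%:~R : 'Z_(p ^ k.+1)) \is a GRing.unit.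
  have unitN (n : nat) : coprime p n -> (n%:R : 'Z_(p ^ k.+1)) \is a GRing.unit.
    by move=> cop; rewrite unitZpE ?Zpk_gt1 // coprimeXl.
  case: m => n /= cop; first exact: unitN.
  by rewrite NegzE rmorphN unitrN; apply: unitN.
move=> cop eqx; have ud := unitZ _ cop; split=> //.
have uq : ((denq (zloc_val x))%:~R : 'Z_(p ^ k.+1)) \is a GRing.unit.
  by apply: unitZ; case: (x).
rewrite /zloc_mod; apply: (mulIr ud); apply: (mulIr uq); rewrite divrK //.
rewrite mulrAC divrK // -!rmorphM /=; congr _%:~R.
apply: (@intr_inj rat); rewrite !rmorphM /= -eqx.
by rewrite numqE; ring.
Qed.
Fact zloc_modE (x : Zloc p) : exists a d : int, coprime p `|d| /\ 
  zloc_val x * d%:~R = a%:~R.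
Proof. by apply/Zloc_predP; case: x. Qed.
Fact zloc_mod_compat (x : Zloc p) k : Zpk_red (zloc_mod k.+1 x) = zloc_mod k x.
Proof.
have [h0 hD] := Zpk_red_add p_pr k; have [h1 hM] := Zpk_red_mul p_pr k.
have hN n : Zpk_red n%:R = n%:R :> 'Z_(p ^ k.+1).
  by rewrite /Zpk_red val_Zp_nat ?Zpk_gt1 // Zpk_mod.
have hZ (m : int) : Zpk_red m%:~R = m%:~R :> 'Z_(p ^ k.+1).
  case: m => n; first exact: hN.
  by rewrite NegzE !rmorphN /= Zpk_redN // hN.
have [a [d [hd ea]]] := zloc_modE x.
have [-> ud'] := zloc_modP k.+1 hd ea; have [-> ud] := zloc_modP k hd ea.
by apply: (mulIr ud); rewrite divrK // -[in LHS]hZ -hM divrK.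
Qed.
Definition zloc_zp (x : Zloc p) : padic_int p_pr := PadicInt p_pr (zloc_mod_compat x).
Fact zloc_zp_add : nmod_morphism zloc_zp.
Proof.
split=> [|x y]; apply: zp_eq => k.
  have [|e _] := @zloc_modP k 0 0 1 (coprimen1 _); first by rewrite mulr1.
  by rewrite [LHS]e mul0r.
have [a [d [hd ea]]] := zloc_modE x; have [b [e [he eb]]] := zloc_modE y.
have [xE ud] := zloc_modP k hd ea; have [yE ue] := zloc_modP k he eb.
have [||] := @zloc_modP k (x + y) (a * e + b * d) (d * e).
- by rewrite abszM coprimeMr hd he.
- by rewrite rmorphD !rmorphM /= -ea -eb; ring.
move=> /= -> ude; rewrite xE yE; apply: (mulIr ude); rewrite divrK //.
rewrite rmorphM /= mulrDl mulrA divrK // [d%:~R * _]mulrC mulrA divrK //.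
by rewrite rmorphD !rmorphM.
Qed.
Fact zloc_zp_mul : monoid_morphism zloc_zp.
Proof.
split=> [|x y]; apply: zp_eq => k.
  have [|e _] := @zloc_modP k 1 1 1 (coprimen1 _); first by rewrite mulr1.
  by rewrite [LHS]e divr1.
have [a [d [hd ea]]] := zloc_modE x; have [b [e [he eb]]] := zloc_modE y.
have [xE ud] := zloc_modP k hd ea; have [yE ue] := zloc_modP k he eb.
have [||] := @zloc_modP k (x * y) (a * b) (d * e).
- by rewrite abszM coprimeMr hd he.
- by rewrite !rmorphM /= -ea -eb; ring.
move=> /= -> ude; rewrite xE yE; apply: (mulIr ude); rewrite divrK //.
by rewrite !rmorphM /= mulrACA !divrK // .
Qed.
HB.instance Definition _ := GRing.isNmodMorphism.Build (Zloc p) (padic_int p_pr)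
  zloc_zp zloc_zp_add.
HB.instance Definition _ := GRing.isMonoidMorphism.Build (Zloc p) (padic_int p_pr)
  zloc_zp zloc_zp_mul.
End ZlocToZp.

Section EvalP.
Variables (p : nat) (p_pr : prime p).
Definition fps_atp_mod k (f : fps (padic_int p_pr)) : 'Z_(p ^ k.+1) :=
  \sum_(n < k.+1) zp_mod k (f n) * p%:R ^+ n.
Fact p_expk k : p%:R ^+ k.+1 = 0 :> 'Z_(p ^ k.+1).
Proof. by rewrite -natrX; apply/val_inj; rewrite /= val_Zp_nat ?Zpk_gt1 // modnn. Qed.
Fact fps_atp_compat f k : Zpk_red (fps_atp_mod k.+1 f) = fps_atp_mod k f.
Proof.
have [h0 hD] := Zpk_red_add p_pr k; have [h1 hM] := Zpk_red_mul p_pr k.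
have hX x n : Zpk_red (x ^+ n) = Zpk_red x ^+ n :> 'Z_(p ^ k.+1).
  by elim: n => // n IHn; rewrite !exprS hM IHn.
have hp : Zpk_red p%:R = p%:R :> 'Z_(p ^ k.+1).
  by rewrite /Zpk_red val_Zp_nat ?Zpk_gt1 // Zpk_mod.
rewrite /fps_atp_mod (big_morph _ hD h0) big_ord_recr /= hM hX hp p_expk mulr0.
rewrite addr0; apply: eq_bigr => i _; rewrite hM hX hp; congr (_ * _).
exact: zp_compat.
Qed.
(* f(t) |-> f(p), computed modulo each p^(k+1) *)
Definition fps_atp (f : fps (padic_int p_pr)) : padic_int p_pr :=
  PadicInt p_pr (fps_atp_compat f).
Fact fps_atp_add : nmod_morphism fps_atp.
Proof.
split=> [|f g]; apply: zp_eq => k /=; rewrite /fps_atp_mod.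
  by rewrite big1 // => i _; rewrite (rmorph0 (zp_mod k)) mul0r.
by rewrite -big_split /=; apply: eq_bigr => i _; rewrite -mulrDl -rmorphD.
Qed.
Fact fps_atp_mul : monoid_morphism fps_atp.
Proof.
split=> [|f g]; apply: zp_eq => k /=; rewrite /fps_atp_mod.
  rewrite big_ord_recl big1 ?addr0 ?expr0 ?mulr1; first exact: rmorph1.
  by move=> i _; rewrite (rmorph0 (zp_mod k)) mul0r.
pose P (h : fps (padic_int p_pr)) := map_poly (zp_mod k) (fps_trunc k.+1 h).
have PE (h : fps (padic_int p_pr)) : (\sum_(n < k.+1) zp_mod k (h n) * p%:R ^+ n) = (P h).[p%:R].
  rewrite (@horner_coef_wide _ k.+1).
    by apply: eq_bigr => i _; rewrite coef_map fps_truncE.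
  by rewrite (leq_trans (size_poly _ _)) // size_poly.
transitivity ((P f).[p%:R] * (P g).[p%:R]); last by rewrite -!PE.
rewrite -hornerM.
rewrite (@horner_coef_wide _ (k.+1 + k.+1)); last first.
  have sz h : (size (P h) <= k.+1)%N.
    by rewrite (leq_trans (size_poly _ _)) // size_poly.
  apply: (leq_trans (size_polyMleq _ _)); apply: (leq_trans (leq_pred _)); exact: leq_add.
rewrite big_split_ord /= [X in _ + X]big1 ?addr0; last first.
  by move=> i _; rewrite exprD p_expk mul0r mulr0.
apply: eq_bigr => i _; congr (_ * _).
rewrite -rmorphM coef_map /=; congr (zp_mod _ _).
exact: fps_mulE.
Qed.
HB.instance Definition _ := GRing.isNmodMorphism.Build (fps (padic_int p_pr)) (padic_int p_pr)
  fps_atp fps_atp_add.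
HB.instance Definition _ := GRing.isMonoidMorphism.Build (fps (padic_int p_pr)) (padic_int p_pr)
  fps_atp fps_atp_mul.
End EvalP.

Definition invertible (R : comNzRingType) (x : R) : Prop := exists y, x * y = 1.

Definition local_ring (R : comNzRingType) : Prop :=
  forall x : R, invertible x \/ invertible (1 - x).

(* A ring has at most one structure of Z_(p)-algebra, and has one exactly when
   every integer prime to p becomes invertible in it. *)
Definition Zloc_algebra (p : nat) (R : comNzRingType) : Prop :=
  forall m : nat, coprime p m -> invertible (m%:R : R).

Fact Zloc_algebra_map p (R S : comNzRingType) (f : {rmorphism R -> S}) :
  Zloc_algebra p R -> Zloc_algebra p S.
Proof.
by move=> h m /h[y hy]; exists (f y); rewrite -(rmorph_nat f) -rmorphM hy rmorph1.
Qed.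
Fact Zloc_algebra_Zloc p : prime p -> Zloc_algebra p (Zloc p).
Proof.
move=> p_pr m cop.
have m0 : (m%:R : rat) != 0.
  by rewrite pnatr_eq0; apply: contraTneq cop => ->; rewrite /coprime gcdn0 gtn_eqF ?prime_gt1.
have hm : (m%:R^-1 : rat) \in Zloc_pred p.
  by apply/Zloc_predP; exists 1, m; split=> //; rewrite mulVf.
exists (ZlocOf hm); apply: val_inj.
by rewrite rmorphM rmorph_nat /= mulfV.
Qed.
Fact Zloc_algebra_Zp p (p_pr : prime p) : Zloc_algebra p (padic_int p_pr).
Proof. exact: (Zloc_algebra_map (zloc_zp p_pr) (Zloc_algebra_Zloc p_pr)). Qed.
Fact Zloc_algebra_rat p : prime p -> Zloc_algebra p rat.
Proof. by move=> p_pr; apply: (Zloc_algebra_map (\val : {rmorphism Zloc p -> rat}) (Zloc_algebra_Zloc p_pr)). Qed.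

(* A closed subscheme of the projective space of dimension pdim over Z_(p).
   Denominators prime to p are units, so equations with coefficients in Z_(p)
   can be taken with integer coefficients.
   The scheme is used through its points with values in local Z_(p)-algebras R,
   which are the unimodular vectors of homogeneous coordinates (over a local
   ring: with an invertible coordinate) up to a unit. Every proper smooth curve
   of genus >= 2 over Z_(p), and every abelian scheme over Z_(p), is of this
   form. *)
Record pscheme (p : nat) := PScheme {
  pdim : nat;
  peqs : seq {mpoly int[pdim.+1]};
  peqs_homog : forall F, F \in peqs -> exists d, F \is d.-homog }.

(* There are no points over rings that are not Z_(p)-algebras. *)
Record point p (X : pscheme p) (R : comNzRingType) := Point {
  coord :> 'I_(pdim X).+1 -> R;
  point_base : Zloc_algebra p R;
  coord_invertible : exists i, invertible (coord i);
  coord_peqs : forall F, F \in peqs X -> mmap intr coord F = 0 }.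

Definition peq p (X : pscheme p) (R : comNzRingType) (x y : point X R) : Prop :=
  exists u : R, invertible u /\ forall i, y i = u * x i.
Notation "x ~= y" := (peq x y) (at level 70, no associativity).

Section PointMap.
Variables (p : nat) (X : pscheme p) (R S : comNzRingType).
Variables (f : {rmorphism R -> S}) (x : point X R).
Fact point_map_invertible : exists i, invertible (f (x i)).
Proof.
by have [i [y hy]] := coord_invertible x; exists i, (f y); rewrite -rmorphM hy rmorph1.
Qed.
Fact point_map_peqs F : F \in peqs X -> mmap intr (fun i => f (x i)) F = 0.
Proof.
move=> /(coord_peqs x) h; rewrite -(rmorph0 f) -h /mmap rmorph_sum.
apply: eq_bigr => m _; rewrite rmorphM rmorph_int; congr (_ * _).
rewrite /mmap1 rmorph_prod; apply: eq_bigr => i _.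
by rewrite rmorphXn.
Qed.
Definition point_map : point X S :=
  Point (Zloc_algebra_map f (point_base x)) point_map_invertible point_map_peqs.
End PointMap.

(* A morphism of Z_(p)-schemes, as a natural transformation between the functors
   of points on local Z_(p)-algebras (with respect to all ring morphisms, local
   or not). For X reduced and irreducible, in particular for the smooth schemes
   with geometrically integral generic fibre used below and their fibre
   products, these are exactly the morphisms of schemes X -> Y: the values at
   the points Spec O_(X,x) -> X spread out to open neighbourhoods, where they
   agree because they agree at the generic point and Y is separated. The values
   at rings that are not local are irrelevant and unconstrained. *)
Record scheme_mor p (X Y : pscheme p) := SchemeMor {
  mor_fun :> forall R : comNzRingType, point X R -> point Y R;
  mor_peq : forall (R : comNzRingType) (x y : point X R), local_ring R ->
    x ~= y -> mor_fun x ~= mor_fun y;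
  mor_natural : forall (R S : comNzRingType) (f : {rmorphism R -> S})
    (x : point X R), local_ring R -> local_ring S ->
    mor_fun (point_map f x) ~= point_map f (mor_fun x) }.

(* The infinitesimal lifting criterion, on local rings; X is of finite
   presentation, so this is smoothness (hence flatness) over Z_(p). *)
Definition smooth p (X : pscheme p) : Prop :=
  forall (A B : comNzRingType) (f : {rmorphism A -> B}),
    Zloc_algebra p A -> local_ring A -> local_ring B ->
    (forall y, exists x, f x = y) ->
    (forall a a', f a = 0 -> f a' = 0 -> a * a' = 0) ->
  forall y : point X B, exists x : point X A, point_map f x ~= y.

(* The tangent space at x is the set of K[e]-points above x, on which r in K
   acts by e |-> r e; it must be a line at every point of every fibre. *)
Definition relative_dim1 p (X : pscheme p) : Prop :=
  forall (K : fieldType) (x : point X K), exists v : point X (dual K),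
  [/\ point_map (@dual_fst K) v ~= x,
      forall w : point X (dual K), point_map (@dual_fst K) w ~= x ->
        exists r : K, w ~= point_map (dual_scale r) v
    & forall r s : K, point_map (dual_scale r) v ~= point_map (dual_scale s) v -> r = s].

(* Irreducibility of the fibre over an algebraically closed field K; the fibres
   are reduced because this is only used together with smooth. *)
Definition integral_over p (X : pscheme p) (K : closedFieldType) : Prop :=
  inhabited (point X K) /\
  forall (d e : nat) (F G : {mpoly K[(pdim X).+1]}),
    F \is d.-homog -> G \is e.-homog ->
    (forall x : point X K, F.@[x] * G.@[x] = 0) ->
    (forall x : point X K, F.@[x] = 0) \/ (forall x : point X K, G.@[x] = 0).

(* An element of H^0(X_A, Omega^1): a function on the total space of the tangent
   bundle (whose R-points are the points of X over R[e]) that is homogeneous of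
   degree 1 along the fibres. The tangent bundle is the spectrum of
   Sym(Omega^1), and its functions of degree 1 are the sections of Omega^1.
   As for morphisms, only the values at local A-algebras R matter. *)
Record oneform p (X : pscheme p) (A : comNzRingType) := OneForm {
  oneform_fun :> forall (R : comNzRingType) (phi : {rmorphism A -> R}),
    point X (dual R) -> R;
  oneform_peq : forall (R : comNzRingType) (phi : {rmorphism A -> R})
    (v w : point X (dual R)), local_ring R ->
    v ~= w -> oneform_fun phi v = oneform_fun phi w;
  oneform_natural : forall (R S : comNzRingType) (phi : {rmorphism A -> R})
    (psi : {rmorphism A -> S}) (f : {rmorphism R -> S}) (v : point X (dual R)),
    local_ring R -> local_ring S -> (forall a, f (phi a) = psi a) ->
    oneform_fun psi (point_map (dual_map f) v) = f (oneform_fun phi v);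
  oneform_scale : forall (R : comNzRingType) (phi : {rmorphism A -> R}) (r : R)
    (v : point X (dual R)), local_ring R ->
    oneform_fun phi (point_map (dual_scale r) v) = r * oneform_fun phi v }.

(* eta = c_0 w_0 + ... + c_(g-1) w_(g-1) *)
Definition oneform_eq_comb p (X : pscheme p) (A : comNzRingType) (g : nat)
    (w : 'I_g -> oneform X A) (eta : oneform X A) (c : 'I_g -> A) : Prop :=
  forall (R : comNzRingType) (phi : {rmorphism A -> R}) (v : point X (dual R)),
    local_ring R -> eta R phi v = \sum_j phi (c j) * w j R phi v.

Definition oneform_basis p (X : pscheme p) (A : comNzRingType) (g : nat)
    (w : 'I_g -> oneform X A) : Prop :=
  forall eta : oneform X A, exists c, oneform_eq_comb w eta c /\
    forall c', oneform_eq_comb w eta c' -> c' =1 c.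

(* A smooth proper model over Z_(p) of a smooth, proper, geometrically integral
   curve of genus g over the rationals, the genus being the dimension of the
   space of global 1-forms of the generic fibre. *)
Record curve p (g : nat) (C : pscheme p) : Prop := Curve {
  curve_smooth : smooth C;
  curve_dim1 : relative_dim1 C;
  curve_integral : forall K : closedFieldType, [pchar K] =i pred0 ->
    integral_over C K;
  curve_genus : exists w : 'I_g -> oneform C rat, oneform_basis w }.

(* An abelian scheme over Z_(p) *)
Record abscheme (p : nat) := AbScheme {
  ab_scheme :> pscheme p;
  ab_smooth : smooth ab_scheme;
  ab_integral : forall K : closedFieldType, Zloc_algebra p K ->
    integral_over ab_scheme K;
  ab_zero : forall R : comNzRingType, Zloc_algebra p R -> point ab_scheme R;
  ab_opp : scheme_mor ab_scheme ab_scheme;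
  ab_add : forall R : comNzRingType,
    point ab_scheme R -> point ab_scheme R -> point ab_scheme R;
  ab_zero_natural : forall (R S : comNzRingType) (f : {rmorphism R -> S})
    (hR : Zloc_algebra p R) (hS : Zloc_algebra p S),
    local_ring R -> local_ring S -> ab_zero hS ~= point_map f (ab_zero hR);
  ab_add_peq : forall (R : comNzRingType) (x x' y y' : point ab_scheme R),
    local_ring R -> x ~= x' -> y ~= y' -> ab_add x y ~= ab_add x' y';
  ab_add_natural : forall (R S : comNzRingType) (f : {rmorphism R -> S})
    (x y : point ab_scheme R), local_ring R -> local_ring S ->
    ab_add (point_map f x) (point_map f y) ~= point_map f (ab_add x y);
  ab_addA : forall (R : comNzRingType) (x y z : point ab_scheme R),
    local_ring R -> ab_add x (ab_add y z) ~= ab_add (ab_add x y) z;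
  ab_addC : forall (R : comNzRingType) (x y : point ab_scheme R),
    local_ring R -> ab_add x y ~= ab_add y x;
  ab_add0 : forall (R : comNzRingType) (hR : Zloc_algebra p R)
    (x : point ab_scheme R), local_ring R -> ab_add (ab_zero hR) x ~= x;
  ab_addN : forall (R : comNzRingType) (hR : Zloc_algebra p R)
    (x : point ab_scheme R), local_ring R ->
    ab_add (ab_opp R x) x ~= ab_zero hR }.

Section AbelianOps.
Variables (p : nat) (J : abscheme p) (R : comNzRingType).
Variable hR : Zloc_algebra p R.
Definition ab_sub (x y : point J R) : point J R := ab_add x (ab_opp J R y).
Definition ab_sum (s : seq (point J R)) : point J R :=
  foldr (@ab_add p J R) (ab_zero J hR) s.
Definition ab_muln (n : nat) (x : point J R) : point J R := ab_sum (nseq n x).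
Definition ab_mulz (z : int) (x : point J R) : point J R :=
  match z with Posz n => ab_muln n x | Negz n => ab_opp J R (ab_muln n.+1 x) end.
Definition ab_comb (r : nat) (c : 'I_r -> int) (z : 'I_r -> point J R) : point J R :=
  ab_sum [seq ab_mulz (c i) (z i) | i <- enum 'I_r].
End AbelianOps.

(* A K[[t]]-point c of C reducing to P is a formal arc through P; the order of
   vanishing of a form F at P is the minimum over these arcs of the t-adic
   order of F(c), reached when t is a uniformiser at P. A rational function on C
   is a quotient F / G of forms of the same degree that do not vanish
   identically on C. principal s t says that the divisor
   sum_(P in s) P - sum_(Q in t) Q is principal. *)
Section Divisors.
Variables (p : nat) (C : pscheme p) (K : closedFieldType).
Definition order_ge (F : {mpoly K[(pdim C).+1]}) (P : point C K) (m : nat) :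
    Prop :=
  forall c : point C (fps K), point_map (@fps_const K) c ~= P ->
  forall i, (i < m)%N -> (mmap (@fpsC K) c F : fps K) i = 0.
Definition order_eq (F : {mpoly K[(pdim C).+1]}) (P : point C K) (m : nat) :
    Prop :=
  order_ge F P m /\ ~ order_ge F P m.+1.
Definition multiplicity (s : seq (point C K)) (P : point C K) : nat :=
  count (fun Q => `[< Q ~= P >]) s.
Definition principal (s t : seq (point C K)) : Prop :=
  exists (d : nat) (F G : {mpoly K[(pdim C).+1]}),
  [/\ F \is d.-homog, G \is d.-homog,
      exists P : point C K, F.@[P] <> 0,
      exists P : point C K, G.@[P] <> 0
    & forall P : point C K, exists a b : nat,
      [/\ order_eq F P a, order_eq G P b
        & (a + multiplicity t P = b + multiplicity s P)%N]].
End Divisors.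

(* The point of J attached to sum_(P in s) P - sum_(Q in t) Q *)
Definition divisor_class p (C : pscheme p) (J : abscheme p) (AJ : scheme_mor C J)
    (K : closedFieldType) (hK : Zloc_algebra p K) (s t : seq (point C K)) :
    point J K :=
  ab_sub (ab_sum hK [seq AJ K P | P <- s]) (ab_sum hK [seq AJ K Q | Q <- t]).

(* J is the Jacobian of C and AJ is P |-> [P - b]: on points over algebraically
   closed fields, AJ induces an isomorphism from the group of divisors of degree
   0 modulo the principal ones onto J. An abelian scheme over Z_(p) is
   determined by its generic fibre, so this characterises (J, AJ). *)
Record is_jacobian p (p_pr : prime p) (C : pscheme p) (b : point C (Zloc p))
    (J : abscheme p) (AJ : scheme_mor C J) : Prop := IsJacobian {
  jac_base : AJ _ b ~= ab_zero J (Zloc_algebra_Zloc p_pr);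
  jac_surj : forall (K : closedFieldType) (hK : Zloc_algebra p K)
    (x : point J K), exists s t : seq (point C K),
    size s = size t /\ x ~= divisor_class AJ hK s t;
  jac_inj : forall (K : closedFieldType) (hK : Zloc_algebra p K)
    (s t : seq (point C K)), size s = size t ->
    (divisor_class AJ hK s t ~= ab_zero J hK <-> principal s t) }.

(* r is the dimension of the tensor product of J(Q) with Q. *)
Definition mordell_weil_rank p (p_pr : prime p) (J : abscheme p) (r : nat) :
    Prop :=
  let hQ := Zloc_algebra_rat p_pr in
  exists z : 'I_r -> point J rat,
    (forall c : 'I_r -> int, ab_comb hQ c z ~= ab_zero J hQ ->
      forall i, c i = 0) /\
    (forall x : point J rat, exists (n : nat) (c : 'I_r -> int),
      (0 < n)%N /\ ab_muln hQ n x ~= ab_comb hQ c z).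

Section PadicPoints.
Variables (p : nat) (p_pr : prime p) (J : abscheme p).
Local Notation padic_int := (padic_int p_pr).
Local Notation padic_rat := (padic_rat p_pr).
Let hZp : Zloc_algebra p padic_int := Zloc_algebra_Zp p_pr.

Definition pembed (X : pscheme p) (x : point X (Zloc p)) : point X padic_int :=
  point_map (zloc_zp p_pr) x.
(* reduction to points over Z/p = F_p *)
Definition preduce (X : pscheme p) (x : point X padic_int) : point X 'Z_(p ^ 1) :=
  point_map (zp_mod 0) x.
Definition congr_mod (k : nat) (x y : point J padic_int) : Prop :=
  point_map (zp_mod k) x ~= point_map (zp_mod k) y.
Definition padic_closure (A : point J padic_int -> Prop)
    (x : point J padic_int) : Prop :=
  forall k, exists2 y, A y & congr_mod k x y.

(* closure of J(Z_(p)) in J(Z_p) for the p-adic topology, two points being close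
   when they are congruent modulo a high power of p *)
Definition in_M : point J padic_int -> Prop :=
  padic_closure (fun x => exists y : point J (Zloc p), x = pembed y).
Definition in_M0 (x : point J padic_int) : Prop :=
  in_M x /\ preduce x ~= preduce (ab_zero J hZp).

Definition torsion (x : point J padic_int) : Prop :=
  exists n : nat, (0 < n)%N /\ ab_muln hZp n x ~= ab_zero J hZp.
(* A / A^tors is isomorphic to Z_p^r; a group morphism from a closed subgroup
   of J(Z_p) to Z_p^r is automatically continuous. *)
Definition rank_mod_torsion (A : point J padic_int -> Prop) (r : nat) : Prop :=
  exists phi : point J padic_int -> 'rV[padic_int]_r,
  [/\ forall x y, A x -> A y -> x ~= y -> phi x = phi y,
      forall x y, A x -> A y -> phi (ab_add x y) = phi x + phi y,
      forall v, exists2 x, A x & phi x = v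
    & forall x, A x -> (phi x = 0 <-> torsion x)].
(* A is the closure of the subgroup generated by the E_i. *)
Definition top_generates (r : nat) (E : 'I_r -> point J (Zloc p))
    (A : point J padic_int -> Prop) : Prop :=
  forall x, A x <->
    padic_closure (fun y => exists c : 'I_r -> int,
      y = ab_comb hZp c (fun i => pembed (E i))) x.

(* l is the sum of the series u in Q_p. *)
Definition padic_series (u : nat -> padic_rat) (l : padic_rat) : Prop :=
  forall k, exists N, forall m, (N <= m)%N ->
    exists z : padic_int, l - \sum_(n < m) u n = p%:R ^+ k * tofrac z.

(* I = (x |-> int_0^x w) is the Coleman integral of w based at 0: the unique
   group morphism J(Z_p) -> Q_p which, on the kernel of reduction, is obtained
   by integrating w formally. Every point x of the kernel of reduction is c(p)
   for some formal arc c in J(Z_p[[t]]) with c(0) = 0; if c^* w = f(t) dt, with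
   f = sum_n f_n t^n, then int_0^x w = sum_n f_n p^(n+1) / (n+1). The series f
   is the value of w at the tangent vector c(t + e). *)
Definition coleman_integral (w : oneform J padic_int)
    (I : point J padic_int -> padic_rat) : Prop :=
  [/\ forall x y, x ~= y -> I x = I y,
      forall x y, I (ab_add x y) = I x + I y
    & forall c : point J (fps padic_int),
      point_map (@fps_const padic_int) c ~= ab_zero J hZp ->
      let f : fps padic_int :=
        w (fps padic_int) (@fpsC padic_int) (point_map (@fps_shift padic_int) c) in
      padic_series (fun n => tofrac (f n) * p%:R ^+ n.+1 / n.+1%:R)
        (I (point_map (@fps_atp p p_pr) c))].
End PadicPoints.

Section Procedure.
Variables (p : nat) (p_pr : prime p) (C : pscheme p) (J : abscheme p).
Variables (AJ : scheme_mor C J).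
Local Notation padic_int := (padic_int p_pr).
Local Notation padic_rat := (padic_rat p_pr).
Variable I : oneform J padic_int -> point J padic_int -> padic_rat.

Definition in_V (nu : oneform J padic_int) : Prop :=
  forall m : point J padic_int, in_M m -> p%:R^-1 * I nu m = 0.
Definition in_CC (P : point C padic_int) : Prop :=
  forall nu : oneform J padic_int, in_V nu -> p%:R^-1 * I nu (AJ _ P) = 0.

(* T reduces to the class of the reduction of R minus that of b. *)
Definition residue_of (R : point C padic_int) (T : point J (Zloc p)) : Prop :=
  preduce (pembed p_pr T) ~= AJ _ (preduce R).
Definition passes_sieve (R : point C padic_int) : Prop :=
  exists T : point J (Zloc p), residue_of R T.

Definition log_vec (g : nat) (w : 'I_g -> oneform J padic_int) (x : point J padic_int) :
    'rV[padic_rat]_g :=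
  \row_j (p%:R^-1 * I (w j) x).

(* The set left at the end of the procedure, T R being the point picked in
   J(Z_(p)) for each R that passes the sieve. *)
Definition output (g r : nat) (w : 'I_g -> oneform J padic_int)
    (E : 'I_r -> point J (Zloc p)) (T : point C padic_int -> point J (Zloc p))
    (R : point C padic_int) : Prop :=
  [/\ in_CC R, passes_sieve R
    & exists a : 'I_r -> padic_int,
      log_vec w (ab_sub (AJ _ R) (pembed p_pr (T R))) =
      \sum_i tofrac (a i) *: log_vec w (pembed p_pr (E i))].
End Procedure.

(* Main.v *)
(* Every x in J(Z_p) that vanishes modulo q = p^(k+1) is the end point d(q) of a
   formal arc d with d(0) = 0, by smoothness. Integrating termwise gives
   int_0^x w = q f_0 modulo pq, where d^* w = f(t) dt; this is where p > 2
   enters. So log x vanishes modulo p^k. Conversely, extending the affine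
   coordinates at the origin to invariant 1-forms, which are combinations of the
   w_j, one recovers d'(0) modulo p from log x; hence if x reduces to 0 and log x
   vanishes modulo p^k, then x vanishes modulo p^(k+1). On the kernel of
   reduction the logarithm thus measures the distance to 0.

   Let y = R - b - T, which reduces to 0. If log y = sum a_i log E_i, then
   approximating the a_i by integers c_i makes log (y - sum c_i E_i) small, so y
   is close to sum c_i E_i and lies in M. If y lies in M, hence in M_0, then log y is
   a limit of integral combinations of the log E_i, and the Z_p-span of finitely
   many vectors is closed. No limit in J(Z_p) has to be taken. *)
Require Import Defs.
From HB Require Import structures.
From mathcomp Require Import all_boot all_algebra.
From mathcomp Require Import boolp functions.
From mathcomp Require Import mpoly ring zify.

Set Implicit Arguments.
Unset Strict Implicit.
Unset Printing Implicit Defensive.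

(** * Divisibility and quotients by principal ideals *)

Section Divisibility.
Import GRing.Theory.
Local Open Scope ring_scope.
Variable R : comNzRingType.
Implicit Types (h x y : R).

Definition rdvd h x : Prop := exists y, x = h * y.

Lemma rdvd0 h : rdvd h 0.
Proof. by exists 0; rewrite mulr0. Qed.

Lemma rdvd_refl h : rdvd h h.
Proof. by exists 1; rewrite mulr1. Qed.

Lemma rdvdD h x y : rdvd h x -> rdvd h y -> rdvd h (x + y).
Proof. by move=> [a ->] [b ->]; exists (a + b); rewrite mulrDr. Qed.

Lemma rdvdN h x : rdvd h x -> rdvd h (- x).
Proof. by move=> [a ->]; exists (- a); rewrite mulrN. Qed.

Lemma rdvdB h x y : rdvd h x -> rdvd h y -> rdvd h (x - y).
Proof. by move=> hx hy; apply: rdvdD => //; apply: rdvdN. Qed.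

Lemma rdvdMr h x y : rdvd h x -> rdvd h (y * x).
Proof. by move=> [a ->]; exists (y * a); rewrite mulrCA. Qed.

Lemma rdvdMl h x y : rdvd h x -> rdvd h (x * y).
Proof. by rewrite mulrC; apply: rdvdMr. Qed.

Lemma rdvd_sum h (I : Type) (s : seq I) (F : I -> R) :
  (forall i, rdvd h (F i)) -> rdvd h (\sum_(i <- s) F i).
Proof.
by move=> hF; elim/big_ind: _ => //; [apply: rdvd0 | apply: rdvdD].
Qed.

Lemma rdvd_trans h x y : rdvd h x -> rdvd x y -> rdvd h y.
Proof. by move=> [a ->] [b ->]; exists (a * b); rewrite mulrA. Qed.

Lemma rdvd_exp h m n : (m <= n)%N -> rdvd (h ^+ m) (h ^+ n).
Proof. by move=> le; exists (h ^+ (n - m)); rewrite -exprD subnKC. Qed.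

Lemma invertibleM x y : invertible x -> invertible y -> invertible (x * y).
Proof. by move=> [a ha] [b hb]; exists (a * b); rewrite mulrACA ha hb mulr1. Qed.

Lemma invertible1 : invertible (1 : R).
Proof. by exists 1; rewrite mulr1. Qed.

Lemma invertible_mul x y : invertible (x * y) -> invertible x.
Proof. by move=> [a ha]; exists (y * a); rewrite mulrA. Qed.

Lemma invertible_exp h n : (0 < n)%N -> invertible (h ^+ n) -> invertible h.
Proof. by case: n => // n _; rewrite exprS; apply: invertible_mul. Qed.

End Divisibility.

Section MorphismLemmas.
Import GRing.Theory.
Local Open Scope ring_scope.

Lemma invertible_map (R S : comNzRingType) (f : {rmorphism R -> S}) x :
  invertible x -> invertible (f x).
Proof. by move=> [y xy]; exists (f y); rewrite -rmorphM xy rmorph1. Qed.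

Lemma local_ring_surj (R S : comNzRingType) (f : {rmorphism R -> S}) :
  (forall y, exists x, f x = y) -> local_ring R -> local_ring S.
Proof.
move=> fsurj Rloc y; have [x <-] := fsurj y.
by have [hx|hx] := Rloc x; have := invertible_map f hx;
  rewrite ?rmorphB ?rmorph1; [left|right].
Qed.

Lemma invertible_lift (R S : comNzRingType) (f : {rmorphism R -> S}) :
  (forall y, exists x, f x = y) ->
  (forall a a', f a = 0 -> f a' = 0 -> a * a' = 0) ->
  forall x, invertible (f x) -> invertible x.
Proof.
move=> fsurj fsq x [v xv]; have [y fy] := fsurj v.
have h0 : f (x * y - 1) = 0 by rewrite rmorphB rmorphM fy xv rmorph1 subrr.
have h1 := fsq _ _ h0 h0.
(* One Newton step: [x * y * (2 - x * y)] is 1 minus the square of [x * y - 1], and that square is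
   zero. *)
exists (y * (2%:R - x * y)); apply/eqP; rewrite -subr_eq0 -[X in _ == X]oppr0 -h1.
by apply/eqP; ring.
Qed.

End MorphismLemmas.

Section FactorMorphism.
Import GRing.Theory.
Local Open Scope ring_scope.
Variables (R A B : comNzRingType).
Variables (pa : {rmorphism R -> A}) (pb : {rmorphism R -> B}).
Hypothesis pa_surj : forall y, exists x, pa x = y.
Hypothesis ker_sub : forall x, pa x = 0 -> pb x = 0.

(** The preimage is an arbitrary choice; [ker_sub] makes the value independent of it. *)
Definition factor (y : A) : B := pb (projT1 (cid (pa_surj y))).

Lemma factorE x : factor (pa x) = pb x.
Proof.
rewrite /factor; case: cid => /= x' e; apply/eqP; rewrite -subr_eq0 -rmorphB.
by rewrite ker_sub // rmorphB e subrr.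
Qed.

Fact factor_additive : additive factor.
Proof.
move=> y y'; have [x <-] := pa_surj y; have [x' <-] := pa_surj y'.
by rewrite -rmorphB !factorE rmorphB.
Qed.
Fact factor_multiplicative : multiplicative factor.
Proof.
split=> [y y'|]; last by rewrite -(rmorph1 pa) factorE rmorph1.
have [x <-] := pa_surj y; have [x' <-] := pa_surj y'.
by rewrite -rmorphM !factorE rmorphM.
Qed.
HB.instance Definition _ := GRing.isAdditive.Build A B factor factor_additive.
HB.instance Definition _ :=
  GRing.isMultiplicative.Build A B factor factor_multiplicative.

Lemma factor_morphism :
  exists f : {rmorphism A -> B}, forall x, f (pa x) = pb x.
Proof. by exists factor; apply: factorE. Qed.

End FactorMorphism.

Section PrincipalQuotient.
Import GRing.Theory.
Local Open Scope ring_scope.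
Local Open Scope quotient_scope.
Variables (R : comNzRingType) (h : R).
Hypothesis hN : ~ invertible h.

Definition multiples : {pred R} := fun x => `[< rdvd h x >].

Fact multiples_idealr : idealr_closed multiples.
Proof.
split; first by apply/asboolP; apply: rdvd0.
  by apply/negP => /asboolP[y e]; apply: hN; exists y.
move=> a x y /asboolP hx /asboolP hy; apply/asboolP.
by apply: rdvdD => //; apply: rdvdMr.
Qed.
HB.instance Definition _ := isIdealr.Build R multiples multiples_idealr.

(** Rings here satisfy [1 != 0], so R/h is one only when [h] is not invertible. *)
Lemma principal_quotient : exists (Q : comNzRingType) (f : {rmorphism R -> Q}),
  (forall y, exists x, f x = y) /\ (forall x, f x = 0 <-> rdvd h x).
Proof.
exists {ideal_quot multiples}, \pi_{ideal_quot multiples}; split=> [y|x].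
  by exists (repr y); apply: reprK.
rewrite -(rmorph0 \pi_{ideal_quot multiples}); split.
  move/eqP; rewrite -Quotient.idealrBE subr0 => /asboolP; exact.
by move=> hx; apply/eqP; rewrite -Quotient.idealrBE subr0; apply/asboolP.
Qed.

End PrincipalQuotient.

(** * Adically complete rings *)

Section Completeness.
Import GRing.Theory.
Local Open Scope ring_scope.
Variables (R : comNzRingType) (h : R).

(* [S n] is the sum of the series [g n + h g (n+1) + h^2 g (n+2) + ...]. *)
Definition adic_complete : Prop :=
  forall g : nat -> R, exists S : nat -> R, forall n, S n = g n + h * S n.+1.

Definition adic_separated : Prop :=
  forall x, (forall n, rdvd (h ^+ n) x) -> x = 0.

(** The inverse is the geometric series in [h * a]. Completeness supplies some solution [S] of the
    recurrence; separatedness forces [S 1 = a * S 0], whence [(1 - h * a) * S 0 = 1]. *)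
Lemma complete_invertible1B a :
  adic_complete -> adic_separated -> invertible (1 - h * a).
Proof.
move=> hc hs; have [S hS] := hc (fun n => a ^+ n).
have eqS n m : exists y, S n.+1 - a * S n = h ^+ m * y.
  elim: m n => [|m IHm] n.
    by exists (S n.+1 - a * S n); rewrite expr0 mul1r.
  have [y hy] := IHm n.+1; exists y.
  by rewrite (exprS h) -mulrA -hy {1}(hS n.+1) (hS n) exprS; ring.
have S1 : S 1%N = a * S 0%N by apply/subr0_eq/hs => m; apply: eqS.
by exists (S 0%N); rewrite mulrBl mul1r -mulrA -S1 {1}(hS 0%N) expr0 addrK.
Qed.

Lemma complete_invertible x y : adic_complete -> adic_separated ->
  invertible x -> rdvd h (y - x) -> invertible y.
Proof.
move=> hc hs [v xv] [a ea].
have -> : y = x * (1 - h * - (a * v)).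
  transitivity (h * a * (x * v) + x); last by ring.
  by rewrite xv mulr1 -ea subrK.
apply: invertibleM; first by exists v.
exact: complete_invertible1B.
Qed.

End Completeness.

(** * The ring of p-adic integers *)

Section PadicIntegers.
Import GRing.Theory.
Local Open Scope ring_scope.
Variables (p : nat) (p_pr : prime p).
Local Notation Zp := (padic_int p_pr).

Lemma zp_proj_natr k n : zp_proj (n%:R : Zp) k = n%:R.
Proof. exact: (rmorph_nat (zp_mod (p_pr := p_pr) k)). Qed.

Lemma zp_proj_dvd k (x : Zp) : zp_proj x k = 0 <-> rdvd (p%:R ^+ k.+1) x.
Proof.
split=> [xk|[y ->]]; last first.
  rewrite -natrX [LHS](rmorphM (zp_mod (p_pr := p_pr) k)) [X in X * _]zp_proj_natr.
  by rewrite natrX p_expk // mul0r.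
pose X n : nat := zp_proj x n.
have Xmod n d : (X (n + d) %% p ^ n.+1)%N = X n.
  rewrite zp_proj_mod modn_small //.
  by have := ltn_ord (zp_proj x n); rewrite [X in (_ < X)%N -> _]Zp_cast ?Zpk_gt1.
(* Dividing by p^(k+1) costs k+1 digits: the quotient at level [n] is read off from [x] at level
   k+1+n. *)
have yc n : Zpk_red ((X (k.+1 + n.+1)%N %/ p ^ k.+1)%:R : 'Z_(p ^ n.+2)) =
    (X (k.+1 + n)%N %/ p ^ k.+1)%:R :> 'Z_(p ^ n.+1).
  rewrite /Zpk_red val_Zp_nat ?Zpk_gt1 // Zpk_mod // -[X (k.+1 + n)%N](Xmod _ 1).
  rewrite addn1 -addnS; apply: val_inj => /=; rewrite !val_Zp_nat ?Zpk_gt1 //.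
  by rewrite expnD mulnC -modn_divl modn_mod.
exists (PadicInt p_pr yc); apply: zp_eq => n.
rewrite [RHS](rmorphM (zp_mod (p_pr := p_pr) n)) -natrX /= /zp_mod zp_proj_natr /=.
rewrite -natrM mulnC divnK; last first.
  by rewrite /dvdn [X in (X %% _)%N]/X addSnnS Xmod /X xk.
by apply: val_inj => /=; rewrite val_Zp_nat ?Zpk_gt1 // addnC Xmod.
Qed.

Lemma zp_separated : adic_separated (p%:R : Zp).
Proof. by move=> x xd; apply: zp_eq => k; apply/zp_proj_dvd. Qed.

Lemma fps_atp_shift (f : fps Zp) :
  fps_atp f = f 0%N + p%:R * fps_atp (fun n => f n.+1).
Proof.
apply: zp_eq => k.
rewrite [RHS](rmorphD (zp_mod (p_pr := p_pr) k)) rmorphM /= /zp_mod /=.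
rewrite zp_proj_natr /fps_atp_mod big_ord_recl expr0 mulr1; congr (_ + _).
rewrite big_ord_recr /= mulrDr (mulrCA _ _ (p%:R ^+ k)) -exprS p_expk //.
rewrite mulr0 addr0 mulr_sumr; apply: eq_bigr => i _.
by rewrite exprS mulrCA.
Qed.

(** The sum of the series is the value at p of the power series with coefficients [g (n + m)]. *)
Lemma zp_complete : adic_complete (p%:R : Zp).
Proof.
move=> g; exists (fun n => fps_atp (fun m => g (n + m)%N)) => n.
rewrite fps_atp_shift addn0; congr (_ + _ * fps_atp _).
by apply/funext => m; rewrite addSnnS.
Qed.

Lemma zp_natP k (x : Zp) :
  exists2 c : nat, (c < p ^ k.+1)%N & rdvd (p%:R ^+ k.+1) (x - c%:R).
Proof.
exists (zp_proj x k).
  by have := ltn_ord (zp_proj x k); rewrite [X in (_ < X)%N -> _]Zp_cast ?Zpk_gt1.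
apply/zp_proj_dvd.
rewrite [LHS](rmorphB (zp_mod (p_pr := p_pr) k)) /= /zp_mod zp_proj_natr.
by rewrite natr_Zp subrr.
Qed.

(** Modulo p, [x] is an integer prime to p, which is invertible in Z_p; completeness carries this
    over to [x]. *)
Lemma zp_invertible (x : Zp) : ~ rdvd p%:R x -> invertible x.
Proof.
move=> xN; have [c _ xc] := zp_natP 0 x.
have cop : coprime p c.
  rewrite prime_coprime //; apply/negP => /dvdnP[d dE]; apply: xN.
  rewrite -[x](subrK c%:R); apply: rdvdD; first by rewrite -[p%:R]expr1.
  by exists d%:R; rewrite dE natrM mulrC.
have [v cv] := Zloc_algebra_Zp p_pr cop.
apply: (@complete_invertible _ p%:R c%:R x) => //.
- exact: zp_complete.
- exact: zp_separated.
by exists v.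
Qed.

Lemma zp_p_notinvertible : ~ invertible (p%:R : Zp).
Proof.
move=> [y e]; have := oner_neq0 'Z_(p ^ 1).
rewrite -(rmorph1 (zp_mod (p_pr := p_pr) 0)) => /eqP; apply.
by apply/zp_proj_dvd; exists y; rewrite expr1.
Qed.

Lemma zp_local : local_ring Zp.
Proof.
move=> x; have [px|] := pselect (rdvd p%:R x); last by move/zp_invertible; left.
right; apply: zp_invertible => p1x; apply: zp_p_notinvertible.
by have [y e] := rdvdD p1x px; exists y; rewrite -e subrK.
Qed.

Lemma zp_mod_surj k (y : 'Z_(p ^ k.+1)) : exists x : Zp, zp_mod k x = y.
Proof.
exists (nat_of_ord y)%:R; rewrite [LHS](rmorph_nat (zp_mod (p_pr := p_pr) k)).
exact: natr_Zp.
Qed.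

Lemma zp_natr_neq0 n : (n.+1%:R : Zp) != 0.
Proof.
apply/eqP => /(congr1 (fun x => nat_of_ord (zp_proj x n))).
rewrite zp_proj_natr val_Zp_nat ?Zpk_gt1 //= modn_small //.
exact/ltn_expl/prime_gt1.
Qed.

End PadicIntegers.

(** * Formal power series and dual numbers *)

Section PowerSeries.
Import GRing.Theory.
Local Open Scope ring_scope.
Variable R : comNzRingType.
Implicit Types (f g h : fps R).

Definition fps_t : fps R := fun n => (n == 1)%:R.
Definition fps_tail f : fps R := fun n => f n.+1.

Lemma fps_addE f g n : (f + g) n = f n + g n.
Proof. by []. Qed.

Lemma fps_oppE f n : (- f) n = - f n.
Proof. by []. Qed.

Lemma fps_mulnE f g n : (f * g) n = \sum_(i < n.+1) f i * g (n - i)%N.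
Proof. by []. Qed.

Lemma fps_mul0E f g : (f * g) 0%N = f 0%N * g 0%N.
Proof. by rewrite fps_mulnE big_ord_recl big_ord0 addr0. Qed.

Lemma fpsC_mulE a f n : (fpsC a * f) n = a * f n.
Proof.
by rewrite fps_mulnE big_ord_recl subn0 big1 ?addr0 // => i _; rewrite mul0r.
Qed.

Lemma fps_sumE (I : Type) (s : seq I) (F : I -> fps R) n :
  (\sum_(i <- s) F i) n = \sum_(i <- s) F i n.
Proof. by elim/big_rec2: _ => // i y z _ <-. Qed.

Lemma fps_tmulE f n : (fps_t * f) n = if n is m.+1 then f m else 0.
Proof.
case: n => [|n]; first by rewrite fps_mul0E mul0r.
rewrite fps_mulnE !big_ord_recl /= mul0r add0r mul1r subn1 big1 ?addr0 // => i _.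
by rewrite mul0r.
Qed.

Lemma fps_tailE f : f = fpsC (f 0%N) + fps_t * fps_tail f.
Proof.
by apply/funext => -[|n]; rewrite fps_addE fps_tmulE /= ?addr0 ?add0r.
Qed.

Lemma fps_expn_coef0 h m n : h 0%N = 0 -> (n < m)%N -> forall f, (h ^+ m * f) n = 0.
Proof.
move=> h0; elim: m n => // m IHm n ltnm f.
rewrite exprS -mulrA fps_mulnE big_ord_recl h0 mul0r add0r big1 // => i _.
by rewrite IHm ?mulr0 //=; have := ltn_ord i; rewrite /bump /=; lia.
Qed.

Lemma fps_separated h : h 0%N = 0 -> adic_separated h.
Proof.
move=> h0 f fd; apply/funext => n; have [g ->] := fd n.+1.
exact: fps_expn_coef0.
Qed.

Lemma fps_complete h : h 0%N = 0 -> adic_complete h.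
Proof.
move=> h0 g.
(* The infinite sum is finite in each degree: [h ^+ m] has no terms below degree m, so only m <= j
   matters for coefficient j. *)
pose S n : fps R := fun j => \sum_(m < j.+1) (h ^+ m * g (n + m)%N) j.
have SE n j N : (j < N)%N -> S n j = \sum_(m < N) (h ^+ m * g (n + m)%N) j.
  move=> ltjN; rewrite -(subnKC ltjN) big_split_ord /= [X in _ + X]big1 ?addr0 //.
  by move=> i _; apply: fps_expn_coef0; rewrite // ltnS leq_addr.
exists S => n; apply/funext => j.
rewrite fps_addE (SE n j j.+2) // big_ord_recl /= expr0 mul1r addn0; congr (_ + _).
rewrite [RHS]fps_mulnE.
under [RHS]eq_bigr => i _ do rewrite (SE _ _ j.+1) ?ltnS ?leq_subr // mulr_sumr.
rewrite [RHS]exchange_big; apply: eq_bigr => m _ /=.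
by rewrite /bump /= add1n -addSnnS exprS -mulrA.
Qed.

Lemma fps_invertible f : invertible (f 0%N) -> invertible f.
Proof.
move=> [a fa]; apply: (@complete_invertible _ fps_t (fpsC (f 0%N))).
- exact: fps_complete.
- exact: fps_separated.
- by exists (fpsC a); rewrite -rmorphM fa rmorph1.
by exists (fps_tail f); rewrite {1}(fps_tailE f) addrC addKr.
Qed.

Lemma fps_local : local_ring R -> local_ring (fps R).
Proof.
move=> Rloc f; have [hf|hf] := Rloc (f 0%N); [left|right]; exact: fps_invertible.
Qed.

Lemma dual_invertible (x : dual R) : invertible x.1 -> invertible x.
Proof.
move=> [a xa]; exists (a, - (a * a * x.2)); congr (_, _) => //=.
transitivity (x.2 * a * (1 - x.1 * a)); first by ring.
by rewrite xa subrr mulr0.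
Qed.

Lemma dual_local : local_ring R -> local_ring (dual R).
Proof.
move=> Rloc x; have [hx|hx] := Rloc x.1; [left|right]; exact: dual_invertible.
Qed.

(** The substitution f(t) |-> f(a t). *)
Definition fps_scale (a : R) f : fps R := fun n => a ^+ n * f n.
Fact fps_scale_additive a : additive (fps_scale a).
Proof. by move=> f g; apply/funext => n; rewrite /fps_scale mulrDr mulrN. Qed.
Fact fps_scale_multiplicative a : multiplicative (fps_scale a).
Proof.
split=> [f g|]; apply/funext => n.
  rewrite /fps_scale !fps_mulnE mulr_sumr; apply: eq_bigr => i _.
  by rewrite -{1}(subnKC (ltnSE (ltn_ord i))) exprD mulrACA.
by rewrite /fps_scale /GRing.one /= /fps_one; case: n => [|n]; rewrite ?mulr1 ?mulr0.
Qed.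
HB.instance Definition _ a :=
  GRing.isAdditive.Build (fps R) (fps R) (fps_scale a) (fps_scale_additive a).
HB.instance Definition _ a :=
  GRing.isMultiplicative.Build (fps R) (fps R) (fps_scale a)
    (fps_scale_multiplicative a).

(** The inclusion of R in R[e]; on points it gives the zero tangent vector. *)
Definition dual_const (a : R) : dual R := (a, 0).
Fact dual_const_additive : additive dual_const.
Proof. by move=> a b; congr (_, _) => /=; rewrite subr0. Qed.
Fact dual_const_multiplicative : multiplicative dual_const.
Proof. by split=> // a b; congr (_, _) => /=; rewrite mulr0 mul0r addr0. Qed.
HB.instance Definition _ :=
  GRing.isAdditive.Build R (dual R) dual_const dual_const_additive.
HB.instance Definition _ :=
  GRing.isMultiplicative.Build R (dual R) dual_const dual_const_multiplicative.

End PowerSeries.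

(** * Lifting points of smooth schemes *)

Section Equations.
Import GRing.Theory.
Local Open Scope ring_scope.
Variable n : nat.
Implicit Types F : {mpoly int[n]}.

Lemma mmap_rmorph (R S : comNzRingType) (f : {rmorphism R -> S}) (x : 'I_n -> R) F :
  f (mmap intr x F) = mmap intr (fun i => f (x i)) F.
Proof.
rewrite /mmap rmorph_sum; apply: eq_bigr => m _; rewrite rmorphM rmorph_int.
congr (_ * _); rewrite /mmap1 rmorph_prod; apply: eq_bigr => i _.
by rewrite rmorphXn.
Qed.

Lemma mmap_ext (R : comNzRingType) (x y : 'I_n -> R) F :
  x =1 y -> mmap intr x F = mmap intr y F.
Proof. by move=> /funext ->. Qed.

Lemma mmap_homog (R : comNzRingType) d (u : R) (x : 'I_n -> R) F :
  F \is d.-homog ->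
  mmap intr (fun i => u * x i) F = u ^+ d * mmap intr x F.
Proof.
move=> /dhomogP Fd; rewrite /mmap mulr_sumr big_seq [RHS]big_seq.
apply: eq_bigr => m /Fd <-; rewrite mulrCA; congr (_ * _).
rewrite [X in u ^+ X](mdegE m) -prodrXr -big_split /=; apply: eq_bigr => i _.
by rewrite exprMn.
Qed.

(** Integer polynomials commute with R -> R/h, where the coordinates become equal. An invertible
    [h], for which R/h would be zero, is set apart. *)
Lemma mmap_congr (R : comNzRingType) (h : R) (x y : 'I_n -> R) F :
  (forall i, rdvd h (x i - y i)) -> rdvd h (mmap intr x F - mmap intr y F).
Proof.
move=> xy; have [[v hv]|hN] := pselect (invertible h).
  by exists (v * (mmap intr x F - mmap intr y F)); rewrite mulrA hv mul1r.
have [Q [f [_ fker]]] := principal_quotient hN.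
apply/fker; rewrite rmorphB !mmap_rmorph; apply/subr0_eq; rewrite subr0.
apply/eqP; rewrite subr_eq0; apply/eqP/mmap_ext => i; apply/subr0_eq.
by rewrite -rmorphB; apply/fker.
Qed.

End Equations.

Section Points.
Import GRing.Theory.
Local Open Scope ring_scope.
Variables (p : nat) (X : pscheme p).

Lemma point_scale (R : comNzRingType) (u : R) (x : point X R) :
  invertible u -> exists y : point X R, forall i, y i = u * x i.
Proof.
move=> hu; have yi : exists i, invertible (u * x i).
  by have [i hi] := coord_invertible x; exists i; apply: invertibleM.
have ye F : F \in peqs X -> mmap intr (fun i => u * x i) F = 0.
  by move=> FX; have [d /mmap_homog->] := peqs_homog FX; rewrite coord_peqs // mulr0.
by exists (Point (point_base x) yi ye).
Qed.

Lemma peq_coord (R : comNzRingType) (x y : point X R) :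
  (forall i, x i = y i) -> x ~= y.
Proof. by move=> xy; exists 1; split=> [|i]; [exact: invertible1|rewrite mul1r]. Qed.

Lemma peq_refl (R : comNzRingType) (x : point X R) : x ~= x.
Proof. exact: peq_coord. Qed.

Lemma peq_sym (R : comNzRingType) (x y : point X R) : x ~= y -> y ~= x.
Proof.
move=> [u [[v uv] xy]]; exists v; split; first by exists u; rewrite mulrC.
by move=> i; rewrite xy mulrA (mulrC v) uv mul1r.
Qed.

Lemma peq_trans (R : comNzRingType) (y x z : point X R) :
  x ~= y -> y ~= z -> x ~= z.
Proof.
move=> [u [hu xy]] [v [hv yz]]; exists (v * u); split; first exact: invertibleM.
by move=> i; rewrite yz xy mulrA.
Qed.

Lemma point_map_peq (R S : comNzRingType) (f : {rmorphism R -> S})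
  (x y : point X R) : x ~= y -> point_map f x ~= point_map f y.
Proof.
move=> [u [hu xy]]; exists (f u); split; first exact: invertible_map.
by move=> i /=; rewrite xy rmorphM.
Qed.

Lemma peq_cross (R : comNzRingType) (x y : point X R) i j :
  x ~= y -> x i * y j = y i * x j.
Proof. by move=> [u [_ xy]]; rewrite !xy; ring. Qed.

Lemma peq_invertible (R : comNzRingType) (x y : point X R) i :
  x ~= y -> invertible (x i) -> invertible (y i).
Proof. by move=> [u [hu ->]] hx; apply: invertibleM. Qed.

Lemma peq_ratio (R : comNzRingType) (x y : point X R) i :
  invertible (x i) -> invertible (y i) ->
  (forall j, x i * y j = y i * x j) -> x ~= y.
Proof.
move=> [a xa] [b yb] xy; exists (y i * a); split.
  by exists (x i * b); rewrite mulrACA (mulrC (y i)) mulrACA xa yb mulr1.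
by move=> j; rewrite mulrAC -xy mulrAC xa mul1r.
Qed.

(* Lifts one power of h at a time through the square-zero extensions
   R/h^(n+2) -> R/h^(n+1), the coordinates being corrected by a unit so that
   they agree exactly. *)
Lemma smooth_lift (R : comNzRingType) (h : R) (x : 'I_(pdim X).+1 -> R) :
  smooth X -> Zloc_algebra p R -> local_ring R -> ~ invertible h ->
  adic_complete h -> adic_separated h ->
  (exists i, invertible (x i)) ->
  (forall F, F \in peqs X -> rdvd h (mmap intr x F)) ->
  exists y : point X R, forall i, rdvd h (y i - x i).
Proof.
move=> Xsm RZ Rloc hN hc hs [i0 xi0] xF.
pose good n (y : 'I_(pdim X).+1 -> R) := invertible (y i0) /\
  forall F, F \in peqs X -> rdvd (h ^+ n.+1) (mmap intr y F).
have step n y : exists y', good n y -> good n.+1 y' /\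
    forall i, rdvd (h ^+ n.+1) (y' i - y i).
  have [[yi0 yF]|] := pselect (good n y); last by exists y.
  have hnN m : ~ invertible (h ^+ m.+1) by move/invertible_exp => H; apply/hN/H.
  have [A [pa [pa_surj pa_ker]]] := principal_quotient (hnN n.+1).
  have [B [pb [pb_surj pb_ker]]] := principal_quotient (hnN n).
  have kersub z : pa z = 0 -> pb z = 0.
    by move=> /pa_ker h1; apply/pb_ker; apply: rdvd_trans h1; apply: rdvd_exp.
  have [f fE] := factor_morphism pa_surj kersub.
  have f_surj z : exists a, f a = z.
    by have [c <-] := pb_surj z; exists (pa c); rewrite fE.
  (* The kernel of R/h^(n+2) -> R/h^(n+1) is generated by h^(n+1), and 2(n+1) >= n+2. *)
  have f_sq a a' : f a = 0 -> f a' = 0 -> a * a' = 0.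
    have [c <-] := pa_surj a; have [c' <-] := pa_surj a'; rewrite !fE.
    move=> /pb_ker[e ->] /pb_ker[e' ->]; rewrite -rmorphM; apply/pa_ker.
    rewrite mulrACA -exprD; apply: rdvdMl; apply: rdvd_exp.
    by rewrite addnS addSn !ltnS leq_addr.
  have Bi : exists i, invertible (pb (y i)) by exists i0; apply: invertible_map.
  have BF F : F \in peqs X -> mmap intr (fun i => pb (y i)) F = 0.
    by move=> /yF yFd; rewrite -mmap_rmorph; apply/pb_ker.
  have [z [u [hu zy]]] := Xsm _ _ f (Zloc_algebra_map pa RZ)
    (local_ring_surj pa_surj Rloc) (local_ring_surj pb_surj Rloc) f_surj f_sq
    (Point (Zloc_algebra_map pb RZ) Bi BF).
  have [u' u'E] := f_surj u; rewrite -u'E in hu zy.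
  have [z' z'E] := point_scale z (invertible_lift f_surj f_sq hu).
  have /choice[y' y'E] i : exists c, pa c = z' i by apply: pa_surj.
  have yy' i : rdvd (h ^+ n.+1) (y' i - y i).
    apply/pb_ker; rewrite rmorphB -!fE y'E z'E rmorphM -[f (z i)]/(point_map f z i).
    by rewrite -zy /= fE subrr.
  exists y' => _; split=> //; split=> [|F FX].
    apply: (complete_invertible hc hs yi0).
    by apply: rdvd_trans (yy' i0); rewrite exprS; apply/rdvdMl/rdvd_refl.
  by apply/pa_ker; rewrite mmap_rmorph (mmap_ext _ y'E) coord_peqs.
have good0 : good 0%N x by split=> // F /xF; rewrite expr1.
have /choice[nxt nxtP] (ny : nat * ('I_(pdim X).+1 -> R)) :
  exists y', good ny.1 ny.2 -> good ny.1.+1 y' /\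
    forall i, rdvd (h ^+ ny.1.+1) (y' i - ny.2 i) by apply: step.
pose xs := fix xs n := if n is m.+1 then nxt (m, xs m) else x.
have xs_good n : good n (xs n).
  by elim: n => //= n /(nxtP (n, _))[].
(* The n-th correction is h^(n+1) [gs (n, i)]. Completeness sums the corrections to a vector [y]
   that agrees with [xs n] modulo h^(n+1). *)
have /choice[gs gsE] (ni : nat * 'I_(pdim X).+1) : exists g,
    xs ni.1.+1 ni.2 - xs ni.1 ni.2 = h ^+ ni.1.+1 * g.
  by case: ni => n i; have [_] := nxtP (n, xs n) (xs_good n); apply.
have /choice[S SE] i : exists S : nat -> R,
  forall n, S n = gs (n, i) + h * S n.+1 by apply: hc.
pose y i := x i + h * S i 0%N.
have yxs n i : y i - xs n i = h ^+ n.+1 * S i n.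
  elim: n => [|n IHn]; first by rewrite addrC addKr expr1.
  have -> : xs n.+1 i = xs n i + h ^+ n.+1 * gs (n, i).
    by rewrite -(gsE (n, i)) addrC subrK.
  by rewrite opprD addrA IHn SE !exprS; ring.
have y0 : invertible (y i0).
  by apply: (complete_invertible hc hs xi0); exists (S i0 0%N); rewrite addrC addKr.
(* Each [xs n] satisfies the equations modulo h^(n+1), hence so does [y], for every n; separatedness
   concludes. *)
have yF F : F \in peqs X -> mmap intr y F = 0.
  move=> FX; apply: hs => n; rewrite -[mmap _ _ _](subrK (mmap intr (xs n) F)).
  have [_ /(_ F FX) xsF] := xs_good n.
  apply: (@rdvd_trans _ _ (h ^+ n.+1)); first exact: rdvd_exp.
  by apply: rdvdD => //; apply: mmap_congr => i; exists (S i n).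
exists (Point RZ (ex_intro _ i0 y0) yF) => i; exists (S i 0%N).
by rewrite /= addrC addKr.
Qed.

End Points.

(** * Formal arcs *)

Section Evaluation.
Import GRing.Theory.
Local Open Scope ring_scope.
Variables (p : nat) (p_pr : prime p) (k : nat).
Local Notation Zp := (padic_int p_pr).
Local Notation q := (p%:R ^+ k.+1 : Zp).

Lemma zp_pX_neq0 m : p%:R ^+ m != 0 :> Zp.
Proof.
rewrite -natrX; have : (0 < p ^ m)%N by rewrite expn_gt0 prime_gt0.
by case: (p ^ m)%N => // n _; apply: zp_natr_neq0.
Qed.

(* f(t) |-> f(p^(k+1)) *)
Definition fps_atpX : {rmorphism fps Zp -> Zp} :=
  (@fps_atp p p_pr) \o (fps_scale (p%:R ^+ k)).

Lemma fps_atpC (a : Zp) : fps_atp (fpsC a) = a.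
Proof.
by rewrite fps_atp_shift [X in fps_atp X](_ : _ = 0) ?rmorph0 ?mulr0 ?addr0.
Qed.

Lemma fps_atpX_tail (f : fps Zp) : fps_atpX f = f 0%N + q * fps_atpX (fps_tail f).
Proof.
rewrite /fps_atpX /= fps_atp_shift /fps_scale expr0 mul1r exprS -mulrA.
congr (_ + _ * _); rewrite -[in RHS](fps_atpC (p%:R ^+ k)) -rmorphM.
congr fps_atp; apply/funext => n.
by rewrite fpsC_mulE [_ ^+ n.+1]exprS -mulrA fps_atpC.
Qed.

Lemma fps_atpX_linear (a b : Zp) : fps_atpX (fpsC a + fps_t _ * fpsC b) = a + q * b.
Proof.
rewrite fps_atpX_tail fps_addE fps_tmulE addr0; congr (_ + q * _).
rewrite fps_atpX_tail /fps_tail fps_addE fps_tmulE add0r.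
rewrite [X in fps_atpX X](_ : _ = 0) ?rmorph0 ?mulr0 ?addr0 //.
by apply/funext => n; rewrite /fps_tail fps_addE fps_tmulE addr0.
Qed.

(** Horner division by t - q: the values at q of the tails f_n + f_(n+1) t + ... are the
    coefficients of the quotient for n >= 1, and the remainder f(q) for n = 0. *)
Lemma fps_atpX_root (f : fps Zp) :
  fps_atpX f = 0 -> rdvd (fps_t _ - fpsC q) f.
Proof.
pose g n : Zp := fps_atpX (fun m => f (n + m)%N) => f0.
have gS n : g n = f n + q * g n.+1.
  rewrite {1}/g fps_atpX_tail addn0; congr (_ + q * fps_atpX _).
  by apply/funext => m; rewrite /fps_tail addSnnS.
exists (fun n => g n.+1); apply/funext => n.
rewrite mulrBl fps_addE fps_oppE fpsC_mulE fps_tmulE; case: n => [|n].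
  by rewrite sub0r; apply/eqP; rewrite -addr_eq0 -gS; apply/eqP.
by rewrite (gS n.+1) addrK.
Qed.

(** Write f = t f_1. Then q f_1(q) = 0 in the domain Z_p, so f_1 vanishes at q and t - q divides
    it. *)
Lemma fps_dvd_arc (f : fps Zp) :
  f 0%N = 0 -> fps_atpX f = 0 -> rdvd (fps_t _ * (fps_t _ - fpsC q)) f.
Proof.
move=> f0; rewrite fps_atpX_tail f0 add0r => /eqP.
rewrite mulf_eq0 (negPf (zp_pX_neq0 _)) => /eqP/fps_atpX_root[g gE].
by exists g; rewrite (fps_tailE f) f0 rmorph0 add0r gE mulrA.
Qed.

End Evaluation.

Section Arcs.
Import GRing.Theory.
Local Open Scope ring_scope.
Variables (p : nat) (p_pr : prime p) (k : nat) (X : pscheme p).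
Local Notation Zp := (padic_int p_pr).

(** p is nilpotent modulo p^(k+1), so a multiple of p cannot reduce to a unit. *)
Lemma zp_invertible_mod (x : Zp) : invertible (zp_mod k x) -> invertible x.
Proof.
move=> hx; apply: zp_invertible => -[y xy].
have : invertible (zp_mod k (p%:R : Zp)).
  by apply: (@invertible_mul _ _ (zp_mod k y)); rewrite -rmorphM -xy.
rewrite rmorph_nat => -[v /(congr1 (fun w => w ^+ k.+1))].
rewrite exprMn p_expk // mul0r expr1n => /eqP.
by rewrite eq_sym oner_eq0.
Qed.

(* The arc starts from the chord (1 - t/q) z + (t/q) x, q = p^(k+1), which
   satisfies the equations modulo t (t - q) because its two ends do. *)
Lemma smooth_arc (x z : point X Zp) : smooth X ->
  point_map (zp_mod k) x ~= point_map (zp_mod k) z ->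
  exists d : point X (fps Zp),
    point_map (@fps_const Zp) d ~= z /\ point_map (fps_atpX p_pr k) d ~= x.
Proof.
move=> Xsm xz; have [i0 hz] := coord_invertible z.
have hx : invertible (x i0).
  apply: zp_invertible_mod; apply: (peq_invertible (peq_sym xz)).
  exact: invertible_map.
have [a za] := hz; have [b xb] := hx.
(* Both points are normalised to have coordinate [i0] equal to 1, so that their projective
   congruence holds coordinate by coordinate. *)
have [|z' z'E] := @point_scale _ _ _ a z; first by exists (z i0); rewrite mulrC.
have [|x' x'E] := @point_scale _ _ _ b x; first by exists (x i0); rewrite mulrC.
have zz' : z ~= z' by exists a; split=> //; exists (z i0); rewrite mulrC.
have xx' : x ~= x' by exists b; split=> //; exists (x i0); rewrite mulrC.
have z'1 : z' i0 = 1 by rewrite z'E mulrC.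
have x'1 : x' i0 = 1 by rewrite x'E mulrC.
have /choice[tau tauE] i : exists t, x' i - z' i = p%:R ^+ k.+1 * t.
  apply/zp_proj_dvd; rewrite [LHS](rmorphB (zp_mod (p_pr := p_pr) k)).
  apply/eqP; rewrite subr_eq0; apply/eqP.
  have := peq_cross i0 i (peq_trans (point_map_peq (zp_mod k) (peq_sym xx'))
    (peq_trans xz (point_map_peq (zp_mod k) zz'))).
  by rewrite /= x'1 z'1 rmorph1 !mul1r => ->.
pose y i : fps Zp := fpsC (z' i) + fps_t _ * fpsC (tau i).
have y0 i : fps_const (y i) = z' i by rewrite /y /fps_const fps_addE fps_tmulE addr0.
have yq i : fps_atpX p_pr k (y i) = x' i.
  by rewrite /y fps_atpX_linear -tauE addrC subrK.
(* The zero constant term makes the power series ring complete and separated for [h]; since [h]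
   vanishes at 0 and at q, a correction by multiples of [h] keeps both ends. *)
pose h : fps Zp := fps_t _ * (fps_t _ - fpsC (p%:R ^+ k.+1)).
have h0 : h 0%N = 0 by rewrite /h fps_tmulE.
have [||||||F FX|d dE] := smooth_lift (h := h) (x := y) Xsm.
- exact: (Zloc_algebra_map (@fpsC Zp) (Zloc_algebra_Zp p_pr)).
- exact/fps_local/zp_local.
- move=> [g /(congr1 (@fps_const Zp))]; rewrite rmorphM rmorph1.
  rewrite /= [fps_const h]h0 mul0r => /eqP.
  by rewrite eq_sym oner_eq0.
- exact: fps_complete.
- exact: fps_separated.
- exists i0; apply: fps_invertible; rewrite -[y i0 _]/(fps_const (y i0)) y0 z'1.
  exact: invertible1.
- apply: fps_dvd_arc.
    rewrite -[_ 0%N]/(fps_const _) mmap_rmorph (mmap_ext _ y0).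
    exact: (coord_peqs z').
  rewrite mmap_rmorph (mmap_ext _ yq).
  exact: (coord_peqs x').
exists d; split.
  apply: peq_trans (peq_sym zz'); apply: peq_coord => i /=.
  have [g /(congr1 (@fps_const Zp))] := dE i; rewrite rmorphB rmorphM /= y0.
  by rewrite [fps_const h]h0 mul0r => /subr0_eq.
apply: peq_trans (peq_sym xx'); apply: peq_coord => i /=.
have [g /(congr1 (fps_atpX p_pr k))] := dE i; rewrite rmorphB [RHS]rmorphM yq.
have -> : fps_atpX p_pr k h = 0.
  rewrite rmorphM (_ : _ - _ = fpsC (- p%:R ^+ k.+1) + fps_t _ * fpsC 1).
    by rewrite fps_atpX_linear mulr1 addNr mulr0.
  by rewrite rmorph1 mulr1 rmorphN addrC.
by rewrite mul0r => /subr0_eq.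
Qed.


End Arcs.

(** * The group law and invariant forms *)

Section GroupLaw.
Import GRing.Theory.
Local Open Scope ring_scope.
Variables (p : nat) (J : abscheme p) (R : comNzRingType).
Hypotheses (hR : Zloc_algebra p R) (Rloc : local_ring R).
Implicit Types x y z : point J R.
Local Notation "0" := (ab_zero J hR).

Lemma ab_oppP x y : x ~= y -> ab_opp J R x ~= ab_opp J R y.
Proof. exact: mor_peq. Qed.

Lemma ab_sub_peq x x' y y' : x ~= x' -> y ~= y' -> ab_sub x y ~= ab_sub x' y'.
Proof. by move=> xx' yy'; apply: ab_add_peq => //; apply: ab_oppP. Qed.

Lemma ab_addr0 x : ab_add x 0 ~= x.
Proof. exact: peq_trans (ab_addC _ _ Rloc) (ab_add0 _ _ Rloc). Qed.

Lemma ab_subxx x : ab_sub x x ~= 0.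
Proof. exact: peq_trans (ab_addC _ _ Rloc) (ab_addN _ _ Rloc). Qed.

Lemma ab_subK x y : ab_add (ab_sub x y) y ~= x.
Proof.
apply: peq_trans (peq_sym (ab_addA _ _ _ Rloc)) _.
apply: peq_trans (ab_addr0 x).
by apply: ab_add_peq; [|exact: peq_refl|exact: ab_addN].
Qed.

Lemma ab_sub_eq0 x y : ab_sub x y ~= 0 <-> x ~= y.
Proof.
split=> [xy|xy]; last first.
  by apply: peq_trans (ab_subxx y); apply: ab_sub_peq => //; apply: peq_refl.
apply: peq_trans (peq_sym (ab_subK x y)) _; apply: peq_trans (ab_add0 hR y Rloc).
by apply: ab_add_peq => //; apply: peq_refl.
Qed.

Lemma ab_subr0 x : ab_sub x 0 ~= x.
Proof. exact: peq_trans (peq_sym (ab_addr0 _)) (ab_subK _ _). Qed.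

Lemma ab_sum_delta (I : eqType) (i : I) (E : I -> point J R) (s : seq I) :
  uniq s ->
  ab_sum hR [seq ab_mulz hR (i == j)%:Z (E j) | j <- s] ~=
    if i \in s then E i else 0.
Proof.
elim: s => [|j s IHs] /=; first by move=> _; apply: peq_refl.
move=> /andP[js /IHs{}IHs]; rewrite in_cons.
have [ij|_] /= := eqVneq i j.
  rewrite -{}ij in js *; rewrite (negPf js) in IHs.
  apply: peq_trans (ab_addr0 _); apply: ab_add_peq => //; exact: ab_addr0.
apply: peq_trans (ab_add0 hR _ Rloc) _ => //.
Qed.

Lemma ab_comb_delta (r : nat) (i : 'I_r) (E : 'I_r -> point J R) :
  ab_comb hR (fun j => (i == j)%:Z) E ~= E i.
Proof. by have := ab_sum_delta i E (enum_uniq 'I_r); rewrite mem_enum. Qed.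

End GroupLaw.

Section GroupLawMap.
Variables (p : nat) (J : abscheme p) (R S : comNzRingType) (f : {rmorphism R -> S}).
Hypotheses (hR : Zloc_algebra p R) (hS : Zloc_algebra p S).
Hypotheses (Rloc : local_ring R) (Sloc : local_ring S).
Implicit Types x y z : point J R.

Lemma ab_opp_map x : ab_opp J S (point_map f x) ~= point_map f (ab_opp J R x).
Proof. exact: mor_natural. Qed.

Lemma ab_sub_map x y :
  ab_sub (point_map f x) (point_map f y) ~= point_map f (ab_sub x y).
Proof.
apply: peq_trans (ab_add_natural _ _ _ Rloc Sloc).
by apply: ab_add_peq => //; [exact: peq_refl|exact: ab_opp_map].
Qed.

Lemma ab_sum_map s :
  ab_sum hS (map (point_map f) s) ~= point_map f (ab_sum (J := J) hR s).
Proof.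
elim: s => [|x s IHs] /=; first exact: ab_zero_natural.
apply: peq_trans (ab_add_natural _ _ _ Rloc Sloc).
by apply: ab_add_peq => //; exact: peq_refl.
Qed.

Lemma ab_mulz_map c x :
  ab_mulz hS c (point_map f x) ~= point_map f (ab_mulz hR c x).
Proof.
have muln n : ab_muln hS n (point_map f x) ~= point_map f (ab_muln hR n x).
  by have := ab_sum_map (nseq n x); rewrite map_nseq.
case: c => n; first exact: muln.
exact: peq_trans (ab_oppP Sloc (muln _)) (ab_opp_map _).
Qed.

Lemma ab_comb_map r (c : 'I_r -> int) (E : 'I_r -> point J R) :
  ab_comb hS c (fun i => point_map f (E i)) ~= point_map f (ab_comb hR c E).
Proof.
rewrite /ab_comb; elim: (enum 'I_r) => [|i s IHs] /=; first exact: ab_zero_natural.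
apply: peq_trans (ab_add_natural _ _ _ Rloc Sloc).
by apply: ab_add_peq => //; exact: ab_mulz_map.
Qed.

(** Turns a congruence between points into a congruence to the origin, which is what the logarithm
    measures. *)
Lemma peq_map_sub x y :
  point_map f x ~= point_map f y <->
  point_map f (ab_sub x y) ~= point_map f (ab_zero J hR).
Proof.
have z := ab_zero_natural J f hR hS Rloc Sloc.
split=> [/(ab_sub_eq0 hS Sloc) e|e].
  apply: peq_trans z; apply: peq_trans e; exact/peq_sym/ab_sub_map.
apply/(ab_sub_eq0 hS Sloc); apply: peq_trans (ab_sub_map _ _) _.
exact: peq_trans (peq_sym z).
Qed.

End GroupLawMap.

Section AdditiveFunctions.
Import GRing.Theory.
Local Open Scope ring_scope.
Variables (p : nat) (J : abscheme p) (R : comNzRingType).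
Hypotheses (hR : Zloc_algebra p R) (Rloc : local_ring R).
Variables (V : comNzRingType) (I : point J R -> V).
Hypothesis I_peq : forall x y, x ~= y -> I x = I y.
Hypothesis I_add : forall x y, I (ab_add x y) = I x + I y.

Lemma additive_zero : I (ab_zero J hR) = 0.
Proof.
have := I_add (ab_zero J hR) (ab_zero J hR); rewrite (I_peq (ab_add0 hR _ Rloc)).
by move/eqP; rewrite -subr_eq subrr eq_sym => /eqP.
Qed.

Lemma additive_opp x : I (ab_opp J R x) = - I x.
Proof.
by apply/eqP; rewrite -addr_eq0 -I_add (I_peq (ab_addN hR _ Rloc)) additive_zero.
Qed.

Lemma additive_sub x y : I (ab_sub x y) = I x - I y.
Proof. by rewrite I_add additive_opp. Qed.

Lemma additive_mulz c x : I (ab_mulz hR c x) = c%:~R * I x.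
Proof.
have muln n : I (ab_muln hR n x) = n%:R * I x.
  elim: n => [|n IHn]; first by rewrite additive_zero mul0r.
  by rewrite [LHS]I_add -/(ab_muln hR n x) IHn mulrS mulrDl mul1r.
case: c => n; first exact: muln.
by rewrite [LHS]additive_opp muln NegzE mulrNz mulNr.
Qed.

Lemma additive_comb r (c : 'I_r -> int) (E : 'I_r -> point J R) :
  I (ab_comb hR c E) = \sum_i (c i)%:~R * I (E i).
Proof.
rewrite /ab_comb -big_enum /=.
elim: (enum 'I_r) => [|i s IHs]; first by rewrite big_nil additive_zero.
by rewrite big_cons [LHS]I_add additive_mulz IHs.
Qed.

End AdditiveFunctions.

(** * Invariant 1-forms from affine coordinates *)

Section CoordinateForms.
Import GRing.Theory.
Local Open Scope ring_scope.
Variables (p : nat) (p_pr : prime p) (J : abscheme p).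
Local Notation Zp := (padic_int p_pr).
Let hZp : Zloc_algebra p Zp := Zloc_algebra_Zp p_pr.

(** A tangent vector at x is carried to the origin by subtracting the zero tangent vector at x. *)
Definition to_origin (R : comNzRingType) (v : point J (dual R)) : point J (dual R) :=
  ab_sub v (point_map (@dual_const R) (point_map (@dual_fst R) v)).

(** A total inverse on an arbitrary commutative ring, with default value 0 outside the units. *)
Definition rinv (R : comNzRingType) (x : R) : R :=
  if pselect (invertible x) is left h then projT1 (cid h) else 0.

Lemma rinvE (R : comNzRingType) (x y : R) : x * y = 1 -> rinv x = y.
Proof.
move=> xy; rewrite /rinv; case: pselect => [hx|[]]; last by exists y.
by case: cid => /= y' xy'; rewrite -[RHS]mulr1 -xy' mulrA (mulrC y) xy mul1r.
Qed.

Lemma rinvK (R : comNzRingType) (x : R) : invertible x -> x * rinv x = 1.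
Proof. by move=> [y xy]; rewrite (rinvE xy). Qed.

Lemma rinv_map (R S : comNzRingType) (f : {rmorphism R -> S}) x :
  invertible x -> rinv (f x) = f (rinv x).
Proof. by move=> hx; apply: rinvE; rewrite -rmorphM rinvK ?rmorph1. Qed.

Lemma ratio_peq (X : pscheme p) (R : comNzRingType) (x y : point X R) i j :
  invertible (x j) -> x ~= y -> x i * rinv (x j) = y i * rinv (y j).
Proof.
move=> hx xy; have hy := peq_invertible xy hx.
rewrite -[LHS]mulr1 -(rinvK hy) mulrACA (mulrC (rinv _) (rinv _)) mulrACA.
by rewrite -[RHS]mulr1 -(rinvK hx) mulrACA (mulrC (x i)) -(peq_cross j i xy); ring.
Qed.

Lemma to_origin_peq (R : comNzRingType) (v w : point J (dual R)) :
  local_ring R -> v ~= w -> to_origin v ~= to_origin w.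
Proof.
move=> Rloc vw; apply: ab_sub_peq => //; first exact: dual_local.
exact/point_map_peq/point_map_peq.
Qed.

Lemma to_origin_map (R S : comNzRingType) (g : {rmorphism dual R -> dual S})
    (v : point J (dual R)) : local_ring R -> local_ring S ->
  (forall x, dual_const (dual_fst (g x)) = g (dual_const (dual_fst x))) ->
  to_origin (point_map g v) ~= point_map g (to_origin v).
Proof.
move=> Rloc Sloc gE.
apply: peq_trans (ab_sub_map g (dual_local Rloc) (dual_local Sloc) _ _).
apply: ab_sub_peq; [exact: dual_local|exact: peq_refl|].
by apply: peq_coord => i /=.
Qed.

Lemma to_origin_fst (R : comNzRingType) (hR : Zloc_algebra p R)
    (v : point J (dual R)) : local_ring R ->
  point_map (@dual_fst R) (to_origin v) ~= ab_zero J hR.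
Proof.
move=> Rloc; apply: peq_trans (peq_sym (ab_sub_map _ (dual_local Rloc) Rloc _ _)) _.
apply/ab_sub_eq0 => //; exact: peq_coord.
Qed.

Variables (i0 : 'I_(pdim J).+1) (i0_inv : invertible (ab_zero J hZp i0)).

(** The translated vector is based at the origin, whose coordinate [i0] is a unit, and an element of
    R[e] is a unit as soon as its constant term is. *)
Lemma to_origin_invertible (R : comNzRingType) (phi : {rmorphism Zp -> R})
  (v : point J (dual R)) : local_ring R -> invertible (to_origin v i0).
Proof.
move=> Rloc; pose hR := Zloc_algebra_map phi hZp; apply: dual_invertible.
have e : point_map phi (ab_zero J hZp) ~= point_map (@dual_fst R) (to_origin v).
  apply/peq_sym; apply: peq_trans (to_origin_fst hR v Rloc) _.
  exact: ab_zero_natural (@zp_local _ p_pr) Rloc.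
exact: peq_invertible e (invertible_map phi i0_inv).
Qed.

Definition coord_form_fun i (R : comNzRingType) (phi : {rmorphism Zp -> R})
  (v : point J (dual R)) : R := (to_origin v i * rinv (to_origin v i0)).2.

Fact coord_form_peq i (R : comNzRingType) (phi : {rmorphism Zp -> R})
    (v w : point J (dual R)) : local_ring R ->
  v ~= w -> coord_form_fun i phi v = coord_form_fun i phi w.
Proof.
move=> Rloc vw; rewrite /coord_form_fun.
have vi := to_origin_invertible phi v Rloc.
by rewrite (ratio_peq i vi (to_origin_peq Rloc vw)).
Qed.

Fact coord_form_natural i (R S : comNzRingType) (phi : {rmorphism Zp -> R})
    (psi : {rmorphism Zp -> S}) (f : {rmorphism R -> S}) (v : point J (dual R)) :
  local_ring R -> local_ring S -> (forall a, f (phi a) = psi a) ->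
  coord_form_fun i psi (point_map (dual_map f) v) = f (coord_form_fun i phi v).
Proof.
move=> Rloc Sloc _; rewrite /coord_form_fun.
have fE x : dual_const (dual_fst (dual_map f x)) =
    dual_map f (dual_const (dual_fst x)).
  by congr (_, _); rewrite rmorph0.
rewrite (ratio_peq i _ (to_origin_map v Rloc Sloc fE)); last first.
  exact: (to_origin_invertible psi).
rewrite /= (rinv_map (dual_map f)); last exact: (to_origin_invertible phi).
exact: (congr1 snd (esym (rmorphM (dual_map f) _ _))).
Qed.

Fact coord_form_scale i (R : comNzRingType) (phi : {rmorphism Zp -> R}) (r : R)
    (v : point J (dual R)) : local_ring R ->
  coord_form_fun i phi (point_map (dual_scale r) v) = r * coord_form_fun i phi v.
Proof.
move=> Rloc; rewrite /coord_form_fun.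
have rE x : dual_const (dual_fst (dual_scale r x)) =
    dual_scale r (dual_const (dual_fst x)).
  by congr (_, _); rewrite /= mulr0.
rewrite (ratio_peq i _ (to_origin_map v Rloc Rloc rE)); last first.
  exact: (to_origin_invertible phi).
rewrite /= (rinv_map (dual_scale r)); last exact: (to_origin_invertible phi).
exact: (congr1 snd (esym (rmorphM (dual_scale r) _ _))).
Qed.

(* The i-th affine coordinate at the origin, as a cotangent vector extended by
   translation to an invariant 1-form. *)
Definition coord_form i : oneform J Zp :=
  OneForm (coord_form_peq i) (coord_form_natural i) (coord_form_scale i).

End CoordinateForms.

(** * The logarithm *)

Section ZlocLocal.
Import GRing.Theory Num.Theory.
Local Open Scope ring_scope.

(** Let x = a/d with d prime to p. If p divides a, it does not divide d - a, and 1 - x = (d -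
    a)/d. *)
Lemma zloc_local (p : nat) : prime p -> local_ring (Zloc p).
Proof.
move=> p_pr.
have inv (x : Zloc p) (a d : int) : coprime p `|d| -> coprime p `|a| ->
    zloc_val x * d%:~R = a%:~R -> invertible x.
  move=> hd ha xE; have a0 : (a%:~R : rat) != 0.
    rewrite intr_eq0; apply: contraTneq ha => ->.
    by rewrite /coprime gcdn0 gtn_eqF ?prime_gt1.
  have hy : (d%:~R / a%:~R : rat) \in Zloc_pred p.
    by apply/Zloc_predP; exists d, a; rewrite divfK.
  exists (ZlocOf hy); apply: val_inj; rewrite rmorphM rmorph1 /=.
  by rewrite mulrA [X in X / _]xE divff.
move=> x; have [a [d [hd xE]]] := zloc_modE x.
have [ha|ha] := boolP (coprime p `|a|); first by left; apply: inv hd ha xE.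
right; apply: (inv _ (d - a) d) => //; last first.
  rewrite (_ : zloc_val (1 - x) = 1 - zloc_val x); last exact: (rmorphB \val).
  by rewrite mulrBl mul1r xE rmorphB.
move: ha hd; rewrite !prime_coprime // negbK => pa; apply: contra => pda.
have : a + (d - a) \in dvdz p by apply: rpredD.
by rewrite addrC subrK.
Qed.

End ZlocLocal.

(** * Closedness of finitely generated Z_p-spans *)

Section ClosedSpan.
Import GRing.Theory.
Local Open Scope ring_scope.
Variables (p : nat) (p_pr : prime p) (r g : nat).
Local Notation Zp := (padic_int p_pr).

(* Compactness of Z_p^r: the p-adic digits of the coefficients are chosen one
   after the other so that they stay compatible with approximations of every
   precision. *)
Lemma zp_span_closed (v : 'I_r -> 'I_g -> Zp) (u : 'I_g -> Zp) :
  (forall k, exists c : 'I_r -> Zp, forall j,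
     rdvd (p%:R ^+ k) (u j - \sum_i c i * v i j)) ->
  exists a : 'I_r -> Zp, forall j, u j = \sum_i a i * v i j.
Proof.
move=> hu.
(* Some coefficients congruent to [c] modulo p^n are correct to precision k. *)
pose approx n (c : 'I_r -> Zp) k := exists c' : 'I_r -> Zp,
  (forall i, rdvd (p%:R ^+ n) (c' i - c i)) /\
  forall j, rdvd (p%:R ^+ k) (u j - \sum_i c' i * v i j).
have step n c : exists e : 'I_r -> Zp, (forall k, approx n c k) ->
    forall k, approx n.+1 (fun i => c i + p%:R ^+ n * e i) k.
  pose digits (e : {ffun 'I_r -> 'I_p}) (i : 'I_r) : Zp := (e i)%:R.
  have [[e he]|nex] := pselect (exists e, forall k,
      approx n.+1 (fun i => c i + p%:R ^+ n * digits e i) k).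
    by exists (digits e).
  exists (fun=> 0) => nc; exfalso; apply: nex.
  apply: contrapT => nex.
  (* There are finitely many vectors of digits. If each one fails at some precision [K e], an
     approximation of precision [\max_e K e] contradicts the failure of its own digits. *)
  have /choice[K hK] (e : {ffun 'I_r -> 'I_p}) : exists k,
      ~ approx n.+1 (fun i => c i + p%:R ^+ n * digits e i) k.
    by apply/existsNP => he; apply: nex; exists e.
  have [c' [c'c c'u]] := nc (\max_e K e)%N.
  have /choice[y yE] i : exists y, c' i - c i = p%:R ^+ n * y := c'c i.
  have /choice[e eE] i : exists e : 'I_p, rdvd p%:R (y i - e%:R).
    by have [m mp ym] := zp_natP 0 (y i); exists (Ordinal (mp : (m < p)%N)).
  apply: (hK (finfun e)); exists c'; split=> [i|j]; last first.
    by apply: rdvd_trans (c'u j); apply/rdvd_exp/leq_bigmax.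
  have [z zE] := eE i; exists z.
  by rewrite /digits ffunE opprD addrA yE -mulrBr zE exprSr mulrA.
have /choice[e eP] (nc : nat * ('I_r -> Zp)) : exists e : 'I_r -> Zp,
    (forall k, approx nc.1 nc.2 k) ->
    forall k, approx nc.1.+1 (fun i => nc.2 i + p%:R ^+ nc.1 * e i) k.
  exact: step.
pose cs := fix cs n := if n is m.+1 then
  (fun i => cs m i + p%:R ^+ m * e (m, cs m) i) else (fun=> 0).
have csP n k : approx n (cs n) k.
  elim: n k => [k|n IHn]; last exact: (eP (n, cs n)).
  have [c hc] := hu k; exists c; split=> // i; exists (c i).
  by rewrite subr0 expr0 mul1r.
(* [S i 0] is the sum of the chosen terms p^n [e (n, cs n) i], with partial sums [cs n i]. *)
have /choice[S SE] i : exists S : nat -> Zp,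
  forall n, S n = e (n, cs n) i + p%:R * S n.+1 by apply: zp_complete.
have Scs n i : S i 0%N - cs n i = p%:R ^+ n * S i n.
  elim: n => [|n IHn]; first by rewrite subr0 expr0 mul1r.
  by rewrite /= opprD addrA IHn SE exprSr; ring.
exists (fun i => S i 0%N) => j; apply/subr0_eq/zp_separated => n.
have [c' [c'c c'u]] := csP n n.
rewrite -[_ - _](subrKA (\sum_i c' i * v i j)); apply: rdvdD => //.
rewrite -sumrB; apply: rdvd_sum => i; rewrite -mulrBl; apply: rdvdMl.
rewrite -(subrKA (cs n i)); apply: rdvdD => //.
by rewrite -opprB; apply: rdvdN; exists (S i n).
Qed.

End ClosedSpan.

Section Logarithm.
Import GRing.Theory.
Local Open Scope ring_scope.
Variables (p : nat) (p_pr : prime p) (p_gt2 : (2 < p)%N) (J : abscheme p).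
Local Notation Zp := (padic_int p_pr).
Local Notation Qp := (padic_rat p_pr).
Let hZp : Zloc_algebra p Zp := Zloc_algebra_Zp p_pr.
Local Notation frac := (@tofrac Zp).

Lemma frac_natr n : frac n%:R = n%:R.
Proof. exact: (rmorph_nat frac). Qed.

Lemma frac_pX n : frac (p%:R ^+ n) = p%:R ^+ n.
Proof. by rewrite (rmorphXn frac) /= frac_natr. Qed.

(** With v the valuation of n, p^v <= n, and 3^v >= v + 2 once v >= 1. For p = 2 the bound fails at
    n = 2. *)
Lemma logn_add2_leq n : (1 < n)%N -> (logn p n + 2 <= n)%N.
Proof.
move=> n1; have : (p ^ logn p n <= n)%N.
  by apply: dvdn_leq (pfactor_dvdnn _ _); apply: ltnW.
case: (logn p n) => [|v] // le; apply: leq_trans le.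
apply: (@leq_trans (3 ^ v.+1)); last by rewrite leq_exp2r.
by elim: v => // v IHv; rewrite expnS; lia.
Qed.

(* Only here is p > 2 needed. *)
Lemma pX_div_natr k n : exists z : Zp,
  (p%:R ^+ k.+1) ^+ n.+2 / n.+2%:R = frac (p%:R ^+ k.+2 * z) :> Qp.
Proof.
have [m cop nE] := pfactor_coprime p_pr (ltn0Sn n.+1).
have := logn_add2_leq (isT : (1 < n.+2)%N); move: nE.
set v := logn p n.+2 => nE le.
have [y my] := Zloc_algebra_Zp p_pr cop.
(* Here n+2 = m p^v and [y] is the inverse of m; the exponent is a true difference because v <=
   n. *)
exists (p%:R ^+ (k.+1 * n.+2 - (k.+2 + v)) * y).
have eq1 : p%:R ^+ k.+1 ^+ n.+2 =
  p%:R ^+ k.+2 * (p%:R ^+ (k.+1 * n.+2 - (k.+2 + v)) * y) * n.+2%:R :> Zp.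
  rewrite [X in _ = _ * X%:R]nE natrM natrX -exprM.
  transitivity (p%:R ^+ (k.+1 * n.+2) * (m%:R * y)); first by rewrite my mulr1.
  rewrite -[in LHS](subnKC (_ : k.+2 + v <= k.+1 * n.+2)%N); last by nia.
  by rewrite !exprD; ring.
apply: (canLR (mulfK _)).
  by rewrite -frac_natr tofrac_eq0 zp_natr_neq0.
by rewrite -(frac_natr n.+2) -(rmorphM frac) -eq1 (rmorphXn frac) /= frac_pX.
Qed.

(** With q = p^(k+1), the integral is the sum of the f_n q^(n+1)/(n+1): the term n = 0 is q f_0 and
    all later ones are divisible by pq. *)
Lemma coleman_estimate (w : oneform J Zp) (Iw : point J Zp -> Qp) k
    (d : point J (fps Zp)) :
  coleman_integral w Iw ->
  point_map (@fps_const Zp) d ~= ab_zero J hZp ->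
  let f : fps Zp := w _ (@fpsC Zp) (point_map (@fps_shift Zp) d) in
  exists z, Iw (point_map (fps_atpX p_pr k) d) =
    frac (p%:R ^+ k.+1 * (f 0%N + p%:R * z)).
Proof.
move=> [Ipeq _ Iser] d0 f.
(* The integral is given by arcs evaluated at p, so the arc is rescaled: c(t) = d(p^k t) has c(p) =
   d(q), and by the chain rule w pulls back along c to p^k f(p^k t) dt. *)
pose a : Zp := p%:R ^+ k; pose c := point_map (fps_scale a) d.
have c0 : point_map (@fps_const Zp) c ~= ab_zero J hZp.
  apply: peq_trans d0; apply: peq_coord => i /=.
  by rewrite /fps_const /fps_scale expr0 mul1r.
have {Iser} := Iser c c0 => /=.
have -> : w _ (@fpsC Zp) (point_map (@fps_shift Zp) c) = fpsC a * fps_scale a f.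
  have e : point_map (dual_scale (fpsC a))
      (point_map (dual_map (fps_scale a)) (point_map (@fps_shift Zp) d)) ~=
      point_map (@fps_shift Zp) c.
    apply: peq_coord => i /=; congr (_, _); apply/funext => n.
    by rewrite /= fpsC_mulE /fps_deriv /fps_scale /= exprS -mulrnAr mulrA.
  have Zloc' := fps_local (@zp_local _ p_pr).
  rewrite -(oneform_peq w (@fpsC Zp) Zloc' e) oneform_scale //.
  rewrite (@oneform_natural _ _ _ w _ _ (@fpsC Zp)) // => b.
  by apply/funext => -[|n]; rewrite /= /fps_scale ?mul1r ?mulr0.
have -> : Iw (point_map (@fps_atp p p_pr) c) = Iw (point_map (fps_atpX p_pr k) d).
  by apply: Ipeq; apply: peq_coord.
set u := fun n => _.
(* Precision p^(k+2) = pq suffices; taking [N.+1] terms ensures that the term n = 0 is present. *)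
move=> /(_ k.+2)[N /(_ N.+1 (leqnSn N))[z0]].
have uE n : u n = frac (f n) * ((p%:R ^+ k.+1) ^+ n.+1 / n.+1%:R).
  rewrite /u fpsC_mulE /fps_scale mulrA -exprS !rmorphM rmorphXn /= frac_pX.
  by rewrite [p%:R ^+ k.+1]exprSr exprMn; ring.
have /choice[zs zsE] n : exists z, u n.+1 = frac (p%:R ^+ k.+2 * z).
  have [z zE] := pX_div_natr k n; exists (f n.+1 * z).
  by rewrite uE zE -rmorphM mulrCA.
rewrite big_ord_recl uE expr1 divr1.
under eq_bigr => i _ do rewrite [u _]zsE.
move=> /eqP; rewrite subr_eq => /eqP ->.
exists (z0 + \sum_(i < N) zs i).
rewrite -rmorph_sum -frac_pX -(frac_pX k.+1) -!rmorphM -!rmorphD /=.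
by rewrite -mulr_sumr !exprSr; congr frac; ring.
Qed.

End Logarithm.

(** * The logarithm measures the distance to the origin *)

Section LogarithmDepth.
Import GRing.Theory.
Local Open Scope ring_scope.
Variables (p : nat) (p_pr : prime p) (p_gt2 : (2 < p)%N) (J : abscheme p).
Local Notation Zp := (padic_int p_pr).
Local Notation Qp := (padic_rat p_pr).
Let hZp : Zloc_algebra p Zp := Zloc_algebra_Zp p_pr.
Local Notation frac := (@tofrac Zp).
Local Notation "0" := (ab_zero J hZp) : jac_scope.
Local Delimit Scope jac_scope with J.

Lemma zp_proj_eq k (x y : Zp) :
  rdvd (p%:R ^+ k.+1) (x - y) -> zp_mod k x = zp_mod k y.
Proof. by move=> /zp_proj_dvd e; apply/subr0_eq; rewrite -rmorphB. Qed.

Lemma coleman_depth (w : oneform J Zp) (Iw : point J Zp -> Qp) k u :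
  coleman_integral w Iw -> congr_mod k u 0%J ->
  exists z, Iw u = frac (p%:R ^+ k.+1 * z).
Proof.
move=> Icol uk; have [d [d0 du]] := smooth_arc (@ab_smooth _ J) uk.
have [Ipeq _ _] := Icol; have [z zE] := coleman_estimate p_gt2 k Icol d0.
by rewrite -(Ipeq _ _ du) zE; eexists.
Qed.

(** At t = 0 the tangent vector d(t + e) is already based at the origin, so the translation changes
    nothing, and the e-coefficient of an affine coordinate is its derivative at t = 0. *)
Lemma coord_form_arc (i0 i : 'I_(pdim J).+1) (hi0 : invertible (0%J i0))
    (d : point J (fps Zp)) :
  point_map (@fps_const Zp) d ~= 0%J ->
  (coord_form hi0 i _ (@fpsC Zp) (point_map (@fps_shift Zp) d) : fps Zp) 0%N =
  (d i * rinv (d i0)) 1%N.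
Proof.
move=> d0; have Zloc := @zp_local _ p_pr.
have hd : invertible (d i0).
  by apply: fps_invertible; apply: peq_invertible (peq_sym d0) hi0.
pose theta : {rmorphism fps Zp -> dual Zp} :=
  dual_map (@fps_const Zp) \o @fps_shift Zp.
pose v := point_map theta d.
have -> : (coord_form hi0 i _ (@fpsC Zp) (point_map (@fps_shift Zp) d) : fps Zp) 0%N
    = coord_form hi0 i _ (@idfun Zp) v.
  have := @oneform_natural _ _ _ (coord_form hi0 i) _ _ (@fpsC Zp) (@idfun Zp)
    (@fps_const Zp) (point_map (@fps_shift Zp) d) (fps_local Zloc) Zloc (fun=> erefl).
  move=> e; rewrite -[LHS]/(fps_const _) -[LHS]e.
  by apply: oneform_peq => //; exact: peq_coord.
have hD := Zloc_algebra_map (@dual_const Zp) hZp.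
have Dloc := dual_local Zloc.
have vE : v ~= to_origin v.
  apply/peq_sym; apply: peq_trans (ab_subr0 hD Dloc v).
  apply: ab_sub_peq => //; first exact: peq_refl.
  apply: peq_trans (peq_sym (ab_zero_natural _ (@dual_const Zp) hZp _ Zloc Dloc)).
  by apply: point_map_peq; apply: peq_trans d0; apply: peq_coord.
have hv : invertible (v i0) by apply: (invertible_map theta).
rewrite /= /coord_form_fun -(ratio_peq i hv vE).
rewrite [v i0]/(theta (d i0)) (rinv_map theta hd) -[v i]/(theta (d i)) -rmorphM.
by [].
Qed.

(* If u = d(q) with q = p^(k+1), the logarithms of u are q d'(0) to first order
   in the coordinates given by the invariant forms, so their divisibility by pq
   forces d(q) to agree with d(0) modulo pq. *)
Lemma log_depth (g : nat) (w : 'I_g -> oneform J Zp)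
    (I : oneform J Zp -> point J Zp -> Qp) m u :
  oneform_basis w -> (forall j, coleman_integral (w j) (I (w j))) ->
  congr_mod 0 u 0%J ->
  (forall j, exists z, I (w j) u = frac (p%:R ^+ m.+1 * z)) ->
  congr_mod m u 0%J.
Proof.
move=> wb Icol u0 Iu.
have [i0 hi0] := coord_invertible (0%J).
(* The congruence to 0 is improved by one power of p at a time, each time with a new arc. *)
suff H k : (k <= m)%N -> congr_mod k u 0%J by apply: H.
elim: k => // k IHk ltkm; have uk := IHk (ltnW ltkm).
have [d [d0 du]] := smooth_arc (@ab_smooth _ J) uk.
pose f (eta : oneform J Zp) : fps Zp := eta _ (@fpsC Zp) (point_map (@fps_shift Zp) d).
(* The integral is q (f_0 + p z) and is divisible by p^(m+1), hence by pq since k < m; cancelling q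
   leaves p dividing f_0. *)
have fw j : rdvd p%:R (f (w j) 0%N).
  have [Ipeq _ _] := Icol j; have [z] := coleman_estimate p_gt2 k (Icol j) d0.
  rewrite (Ipeq _ _ du); have [z' ->] := Iu j; move/eqP.
  rewrite tofrac_eq -(subnKC ltkm) -addSn exprD -mulrA.
  rewrite exprSr -mulrA => /eqP/(mulfI (zp_pX_neq0 p_pr k.+1)) e.
  rewrite -[f _ _](addrK (p%:R * z)) -e; apply: rdvdB; last by exists z.
  by eexists.
(* The coordinate form is a Z_p-combination of the [w j], so its value on the arc at t = 0 inherits
   divisibility by p. *)
have fform i : rdvd p%:R ((d i * rinv (d i0)) 1%N).
  rewrite -(coord_form_arc i hi0 d0).
  have [c [ceq _]] := wb (coord_form hi0 i).
  rewrite ceq; last exact/fps_local/zp_local.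
  rewrite fps_sumE; apply: rdvd_sum => j; rewrite fpsC_mulE.
  exact/rdvdMr/fw.
have hd : invertible (d i0).
  by apply: fps_invertible; apply: peq_invertible (peq_sym d0) hi0.
apply: peq_trans (point_map_peq (zp_mod k.+1) (peq_sym du)) _.
apply: peq_trans _ (point_map_peq (zp_mod k.+1) d0).
have hmap (h : {rmorphism fps Zp -> Zp}) : invertible (zp_mod k.+1 (h (d i0))).
  exact/invertible_map/invertible_map.
apply: (@peq_ratio _ _ _ _ _ i0); [exact: hmap|exact: hmap|move=> j].
pose gj := d j * rinv (d i0).
have dE : d j = gj * d i0 by rewrite -mulrA (mulrC _ (d i0)) rinvK // mulr1.
pose ev0 : {rmorphism fps Zp -> Zp} := @fps_const Zp.
pose evq := fps_atpX p_pr k.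
(* In g(q) = g_0 + q g_1 + q^2 (...), p divides g_1 and pq divides q^2. *)
have gE : zp_mod k.+1 (evq gj) = zp_mod k.+1 (ev0 gj).
  apply: zp_proj_eq; rewrite /evq fps_atpX_tail addrC addKr fps_atpX_tail mulrDr.
  rewrite exprSr; apply: rdvdD.
    have [z zE] := fform j; exists z.
    by rewrite -mulrA -zE.
  rewrite mulrA; apply: rdvdMl; exists (p%:R ^+ k).
  by rewrite -mulrA -exprS.
have hE (h : {rmorphism fps Zp -> Zp}) :
    zp_mod k.+1 (h (d j)) = zp_mod k.+1 (h gj) * zp_mod k.+1 (h (d i0)).
  by rewrite dE (rmorphM h) rmorphM.
change (zp_mod k.+1 (evq (d i0)) * zp_mod k.+1 (ev0 (d j)) =
  zp_mod k.+1 (ev0 (d i0)) * zp_mod k.+1 (evq (d j))).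
by rewrite (hE ev0) (hE evq) gE; ring.
Qed.

End LogarithmDepth.

(** * The procedure *)

Section Sieve.
Import GRing.Theory.
Local Open Scope ring_scope.
Variables (p : nat) (p_pr : prime p) (p_gt2 : (2 < p)%N).
Variables (C : pscheme p) (J : abscheme p) (AJ : scheme_mor C J).
Local Notation Zp := (padic_int p_pr).
Local Notation Qp := (padic_rat p_pr).
Let hZp : Zloc_algebra p Zp := Zloc_algebra_Zp p_pr.
Let Zp_local : local_ring Zp := @zp_local p p_pr.
Local Notation frac := (@tofrac Zp).
Local Notation pembed := (pembed p_pr).
Local Notation "0" := (ab_zero J hZp) : jac_scope.
Local Delimit Scope jac_scope with J.
Local Notation pmod k := (point_map (zp_mod (p_pr := p_pr) k)).

Lemma zpk_local k : local_ring 'Z_(p ^ k.+1).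
Proof. exact: local_ring_surj (@zp_mod_surj _ p_pr k) Zp_local. Qed.

Lemma zpk_algebra k : Zloc_algebra p 'Z_(p ^ k.+1).
Proof. exact: (Zloc_algebra_map (zp_mod (p_pr := p_pr) k) hZp). Qed.

Lemma congr_mod_sub k (x y : point J Zp) :
  congr_mod k x y <-> congr_mod k (ab_sub x y) 0%J.
Proof. exact: (peq_map_sub _ hZp (@zpk_algebra k) Zp_local (@zpk_local k)). Qed.

Lemma congr_mod_ab_sub k (x x' y y' : point J Zp) :
  congr_mod k x x' -> congr_mod k y y' -> congr_mod k (ab_sub x y) (ab_sub x' y').
Proof.
move=> xx' yy'; apply: peq_trans (ab_sub_map _ Zp_local (@zpk_local k) _ _).
apply: peq_trans (peq_sym (ab_sub_map _ Zp_local (@zpk_local k) _ _)) _.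
exact: (ab_sub_peq (@zpk_local k) xx' yy').
Qed.

Lemma congr_mod_ab_add k (x x' y y' : point J Zp) :
  congr_mod k x x' -> congr_mod k y y' -> congr_mod k (ab_add x y) (ab_add x' y').
Proof.
move=> xx' yy'; apply: peq_trans (ab_add_natural _ _ _ Zp_local (@zpk_local k)).
apply: peq_trans (peq_sym (ab_add_natural _ _ _ Zp_local (@zpk_local k))) _.
exact: (ab_add_peq (@zpk_local k) xx' yy').
Qed.

Lemma peq_congr_mod k (x y : point J Zp) : x ~= y -> congr_mod k x y.
Proof. exact: point_map_peq. Qed.

Lemma residue_sub (R : point C Zp) (T : point J (Zloc p)) :
  residue_of AJ R T -> congr_mod 0 (ab_sub (AJ _ R) (pembed T)) 0%J.
Proof.
move=> RT; apply: (iffLR (congr_mod_sub _ _ _)); apply: peq_sym.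
apply: peq_trans RT _.
exact/mor_natural/(@zpk_local 0).
Qed.

(** A Z_(p)-point approximating [AJ _ R] modulo p is a witness for the sieve. *)
Lemma passes_sieveP (R : point C Zp) : in_M (AJ _ R) -> passes_sieve AJ R.
Proof.
move=> /(_ 0%N)[_ [T ->] RT]; exists T.
by apply: peq_trans (peq_sym RT) _; apply/peq_sym/mor_natural/(@zpk_local 0).
Qed.

Lemma in_M_sub (x : point J Zp) (T : point J (Zloc p)) :
  in_M x -> in_M (ab_sub x (pembed T)).
Proof.
move=> xM k; have [_ [y ->] xy] := xM k.
exists (pembed (ab_sub y T)); first by exists (ab_sub y T).
apply: peq_trans (congr_mod_ab_sub xy (peq_refl _)) _.
exact/peq_congr_mod/ab_sub_map/Zp_local/(@zloc_local p p_pr).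
Qed.

Section Generators.
Variables (r : nat) (E : 'I_r -> point J (Zloc p)).
Hypothesis E_gen : top_generates E (@in_M0 p p_pr J).

Lemma comb_in_M0 c : in_M0 (ab_comb hZp c (fun i => pembed (E i))).
Proof.
by apply/E_gen => k; exists (ab_comb hZp c (fun i => pembed (E i)));
  [exists c|exact: peq_refl].
Qed.

Lemma generator_in_M0 i : congr_mod 0 (pembed (E i)) 0%J.
Proof.
(* [E i] is the combination with Kronecker delta coefficients. *)
have [_ e] := comb_in_M0 (fun j => (i == j)%:Z); apply: peq_trans e.
by apply/peq_sym/peq_congr_mod; apply: ab_comb_delta (fun j => pembed (E j)).
Qed.

Variables (g : nat) (w : 'I_g -> oneform J Zp) (I : oneform J Zp -> point J Zp -> Qp).
Hypothesis I_coleman : forall eta, coleman_integral eta (I eta).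

Lemma coleman_sub_comb eta x c :
  I eta (ab_sub x (ab_comb hZp c (fun i => pembed (E i)))) =
  I eta x - \sum_i (c i)%:~R * I eta (pembed (E i)).
Proof.
have [Ipeq Iadd _] := I_coleman eta.
rewrite (additive_sub hZp Zp_local Ipeq Iadd).
by rewrite (additive_comb hZp Zp_local Ipeq Iadd).
Qed.

Lemma frac_int (c : int) : frac c%:~R = c%:~R.
Proof. exact: (rmorph_int frac). Qed.

Lemma padic_p_neq0 : p%:R != 0 :> Qp.
Proof.
by rewrite -[p%:R]expr1 -frac_pX tofrac_eq0 zp_pX_neq0.
Qed.

(** All points involved reduce to 0, so their integrals lie in p Z_p and the logarithms are
    integral. Approximating [y] by combinations of the [E i] puts its logarithm in the closure of
    the span, which is the span itself. *)
Lemma log_in_span y :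
  in_M0 y -> exists a : 'I_r -> Zp,
    log_vec I w y = \sum_i frac (a i) *: log_vec I w (pembed (E i)).
Proof.
move=> yM0; have [_ y0] := yM0.
have /choice[l lE] j : exists l, I (w j) y = frac (p%:R * l).
  exact: (coleman_depth p_gt2 (I_coleman _) y0).
have /choice[v vE] (ij : 'I_r * 'I_g) : exists l,
    I (w ij.2) (pembed (E ij.1)) = frac (p%:R * l).
  exact: (coleman_depth p_gt2 (I_coleman _) (generator_in_M0 _)).
have {}vE i j : I (w j) (pembed (E i)) = frac (p%:R * v (i, j)) := vE (i, j).
have [|a aE] := @zp_span_closed _ p_pr _ _ (fun i j => v (i, j)) l.
  move=> k; have /E_gen/(_ k)[_ [c ->] yc] := yM0.
  exists (fun i => (c i)%:~R) => j.
  (* Congruence modulo p^(k+1) gives integrals divisible by p^(k+1), hence precision p^k after the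
     normalisation by 1/p. *)
  have [z] := coleman_depth p_gt2 (I_coleman (w j)) (iffLR (congr_mod_sub _ _ _) yc).
  rewrite coleman_sub_comb lE.
  under eq_bigr => i _ do rewrite vE -frac_int -(rmorphM frac) mulrCA.
  rewrite -(rmorph_sum frac) -(rmorphB frac) -mulr_sumr -mulrBr => /eqP.
  rewrite tofrac_eq exprS -mulrA => /eqP/(mulfI _) e.
  by exists z; apply: e; rewrite -[p%:R]expr1 zp_pX_neq0.
exists a; apply/rowP => j; rewrite mxE summxE lE aE mulr_sumr rmorph_sum mulr_sumr.
apply: eq_bigr => i _; rewrite !mxE vE /=.
by rewrite [p%:R * (_ * _)]mulrCA (rmorphM frac) [LHS]mulrCA.
Qed.

(** Choose integers c_i congruent to a_i modulo p^(k+1). The integrals of y - sum c_i E_i are sum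
    (a_i - c_i) I(E_i), divisible by p^(k+1), and [log_depth] turns this into a congruence of
    points. *)
Lemma log_approx y (a : 'I_r -> Zp) k : oneform_basis w -> congr_mod 0 y 0%J ->
  log_vec I w y = \sum_i frac (a i) *: log_vec I w (pembed (E i)) ->
  exists c : 'I_r -> int,
    congr_mod k y (ab_comb hZp c (fun i => pembed (E i))).
Proof.
move=> wb y0 ya.
have /choice[c cE] i : exists c : nat, rdvd (p%:R ^+ k.+1) (a i - c%:R).
  by have [c _ ac] := zp_natP k (a i); exists c.
have /choice[e eE] i : exists e, a i - (c i)%:R = p%:R ^+ k.+1 * e := cE i.
exists (fun i => (c i)%:Z); apply/congr_mod_sub.
apply: (log_depth p_gt2 wb (fun j => I_coleman (w j))).
  apply: peq_trans (peq_congr_mod 0 (ab_subxx hZp Zp_local 0%J)).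
  by apply: congr_mod_ab_sub => //; have [] := comb_in_M0 (fun i => (c i)%:Z).
move=> j.
have /choice[v vE] i : exists v, I (w j) (pembed (E i)) = frac (p%:R * v).
  exact: (coleman_depth p_gt2 (I_coleman _) (generator_in_M0 i)).
have Iy : I (w j) y = \sum_i frac (a i) * I (w j) (pembed (E i)).
  have := congr1 (fun u : 'rV_g => u ord0 j) ya; rewrite mxE summxE.
  under eq_bigr => i _ do rewrite !mxE mulrCA.
  rewrite -mulr_sumr; apply: mulfI; rewrite invr_eq0; exact: padic_p_neq0.
exists (\sum_i e i * (p%:R * v i)); rewrite coleman_sub_comb Iy -sumrB.
rewrite mulr_sumr rmorph_sum; apply: eq_bigr => i _.
by rewrite [in RHS]mulrA -eE -mulrBl vE -frac_int -(rmorphB frac) -(rmorphM frac).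
Qed.

End Generators.

End Sieve.

Theorem theorem5p5 (p : nat) (p_pr : prime p) (p_gt2 : 2 < p)
    (g r : nat) (g_ge2 : 2 <= g)
    (C : pscheme p) (C_curve : curve g C) (b : point C (Zloc p))
    (J : abscheme p) (AJ : scheme_mor C J) (J_jac : is_jacobian p_pr b AJ)
    (J_rank : mordell_weil_rank p_pr J r) (r_lt_g : r < g)
    (I : oneform J (padic_int p_pr) -> point J (padic_int p_pr) -> padic_rat p_pr)
    (I_coleman : forall w, coleman_integral w (I w))
    (r' : nat) (M_rank : rank_mod_torsion (@in_M p p_pr J) r')
    (E : 'I_r' -> point J (Zloc p))
    (E_gen : top_generates E (@in_M0 p p_pr J))
    (w : 'I_g -> oneform J (padic_int p_pr)) (w_basis : oneform_basis w)
    (T : point C (padic_int p_pr) -> point J (Zloc p))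
    (T_pick : forall R, in_CC AJ I R -> passes_sieve AJ R ->
      residue_of AJ R (T R)) :
  forall x : point J (padic_int p_pr),
    (exists2 R, output AJ I w E T R & AJ _ R ~= x) <->
    (exists R, AJ _ R ~= x) /\ in_M x.
Proof.
have Zp_local := @zp_local p p_pr; have Zl_local := @zloc_local p p_pr.
have hZl := Zloc_algebra_Zloc p_pr.
move=> x; split=> [[R [CC_R sieve_R [a logR]] Rx]|[[R Rx] xM]].
  split=> [|k]; first by exists R.
  have [c yc] := log_approx p_gt2 E_gen I_coleman k w_basis
    (residue_sub (T_pick R CC_R sieve_R)) logR.
  (* Since (R - b - T) + T = R - b, adding T to the approximation of R - b - T gives a Z_(p)-point
     close to R - b. *)
  pose z := ab_add (ab_comb hZl c E) (T R).
  exists (pembed p_pr z); first by exists z.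
  apply: peq_trans (peq_congr_mod k (peq_sym Rx)) _.
  have RT := ab_subK (Zloc_algebra_Zp p_pr) Zp_local (AJ _ R) (pembed p_pr (T R)).
  apply: peq_trans (peq_congr_mod k (peq_sym RT)) _.
  apply: peq_trans (congr_mod_ab_add yc (peq_refl _)) _.
  apply: peq_congr_mod; apply: peq_trans (ab_add_natural _ _ _ Zl_local Zp_local).
  apply: ab_add_peq => //; last exact: peq_refl.
  exact: ab_comb_map.
have RM : in_M (AJ _ R).
  move=> k; have [y yZ xy] := xM k; exists y => //.
  by apply: peq_trans xy; apply: peq_congr_mod.
have CC_R : in_CC AJ I R.
  (* The forms in V integrate to zero on all of M, so a point with image in M is a Chabauty-Coleman
     point. *)
  by move=> nu nuV; apply: nuV.
have sieve_R := passes_sieveP RM; exists R => //; split=> //.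
(* R - b - T lies in M, which is stable under subtraction of Z_(p)-points, and it reduces to 0 by
   the choice of T. *)
apply: (log_in_span p_gt2 E_gen w I_coleman); split; first exact: in_M_sub.
exact/residue_sub/T_pick.
Qed.
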